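(* Fix an integer $r \ge 3$. If $m = m(n)$ satisfies $m = (1+o(1))n^{r/2}$, then $z(m,n,2,r) = (1+o(1))\sqrt{n}\,m$ as $n \to \infty$.
   Context: The Zarankiewicz number $z(m,n,s,t)$ is the maximum number of edges in a bipartite graph with parts $A$, $B$ of sizes $|A| = m$, $|B| = n$ that contains no complete bipartite subgraph with $s$ vertices in $A$ and $t$ vertices in $B$ (equivalently, the maximum number of $1$s in an $m \times n$ $0/1$ matrix with no $s \times t$ all-ones submatrix). *)

(* Defs.v *)
From mathcomp Require Import all_boot.

Set Implicit Arguments.
Unset Strict Implicit.
Unset Printing Implicit Defensive.

(* A bipartite graph with parts A = 'I_m and B = 'I_n is its edge set
   E : {set 'I_m * 'I_n}.  The s vertices of a forbidden K_{s,t} lie in A and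
   the t vertices in B; the reverse orientation is allowed. *)
Definition biclique_free (m n s t : nat) (E : {set 'I_m * 'I_n}) : bool :=
  ~~ [exists S : {set 'I_m}, exists T : {set 'I_n},
        [&& #|S| == s, #|T| == t & setX S T \subset E]].

(* If s = 0 or t = 0 (and the other part is large enough), no graph is
   biclique-free and the value is 0 by the convention for an empty \max. *)
Definition zarankiewicz (m n s t : nat) : nat :=
  \max_(E : {set 'I_m * 'I_n} | biclique_free s t E) #|E|.

(* Main.v *)
(* Upper bound: the neighbourhoods of the vertices of A contain each r-subset of B at most
   once, and the tangent line of t^r at sqrt n turns this into a bound on the sum of the
   degrees.  Lower bound: for a prime power q <= sqrt n, the graphs of the polynomials of
   degree < r over F_q are q^r sets of q points of F_q^2, any two of which share fewer than
   r points.

   It remains to find prime powers between x and (1 + eps) x.  This is Erdos's deduction from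
   Selberg's formula psi(x) ln x + sum_k L(k) psi(x/k) = 2 x ln x + O(x), with L the von
   Mangoldt function and psi its summatory function.  If (x, lam x] contains no prime power,
   then for almost all k, in the sense of the weights L(k)/k, the interval (x/k, lam x/k] has
   the maximal density 2 of prime powers ("k is saturated").  Around a suitable v the
   exceptions are negligible, both near v and near x/v.  Since an interval where prime powers
   are frequent ("rich") contains saturated k, its image under y |-> x/y, enlarged at both
   ends, is again rich.  Reflecting back and forth yields arbitrarily long intervals of
   density above 1, against Mertens' estimate sum_{k<=x} L(k)/k = ln x + O(1). *)
Require Import Defs.
From mathcomp Require Import all_boot all_order all_algebra all_field.
From mathcomp Require Import all_classical all_reals all_analysis.
From mathcomp Require Import ring lra zify.
Import Order.TTheory GRing.Theory Num.Theory numFieldNormedType.Exports.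
Local Open Scope ring_scope.

Set Implicit Arguments.
Unset Strict Implicit.
Unset Printing Implicit Defensive.

(** * Divisor sums *)

Section DivisorSums.
Variable V : nmodType.

Lemma sum_divisors (f : nat -> V) (n N : nat) : (0 < n <= N)%N ->
  \sum_(d <- divisors n) f d = \sum_(1 <= d < N.+1 | (d %| n)%N) f d.
Proof.
move=> /andP[n_gt0 le_nN]; rewrite -[RHS]big_filter; apply: perm_big.
apply: uniq_perm; rewrite ?divisors_uniq ?filter_uniq ?iota_uniq // => d.
rewrite -dvdn_divisors // mem_filter mem_index_iota ltnS.
case: (boolP (d %| n)%N) => //= d_n.
by rewrite (dvdn_gt0 n_gt0 d_n) (leq_trans (dvdn_leq n_gt0 d_n)).
Qed.

Lemma sum_nat_dvd (f : nat -> V) (P : pred nat) (d N : nat) : (0 < d)%N ->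
  \sum_(1 <= k < N.+1 | (d %| k)%N && P k) f k =
  \sum_(1 <= j < (N %/ d).+1 | P (d * j)%N) f (d * j)%N.
Proof.
move=> d_gt0.
rewrite -big_filter -[RHS](big_map (muln d) P) -[RHS]big_filter.
apply: perm_big; apply: uniq_perm.
- by rewrite filter_uniq ?iota_uniq.
- rewrite filter_uniq // map_inj_uniq ?iota_uniq // => i j /eqP.
  by rewrite eqn_pmul2l // => /eqP.
move=> k; rewrite !mem_filter mem_index_iota ltnS andbC andbA.
case: (P k); rewrite ?(andbT, andbF) //=; apply/idP/mapP => [|[j]].
- move=> /andP[/andP[k_gt0 le_kN] /dvdnP[j def_k]]; exists j; last by rewrite mulnC.
  move: k_gt0 le_kN; rewrite def_k mem_index_iota ltnS leq_divRL // muln_gt0.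
  by case/andP=> -> _ ->.
- rewrite mem_index_iota ltnS leq_divRL // => /andP[j_gt0 le_j] ->.
  by rewrite muln_gt0 d_gt0 j_gt0 dvdn_mulr // mulnC le_j.
Qed.

(** The pairs [(d, j)] with [d * j <= N] are regrouped according to their product [k]. *)
Lemma sum_dvd_swap (f : nat -> nat -> V) (N : nat) :
  \sum_(1 <= d < N.+1) \sum_(1 <= j < (N %/ d).+1) f d (d * j)%N =
  \sum_(1 <= k < N.+1) \sum_(d <- divisors k) f d k.
Proof.
under eq_big_nat => d /andP[d_gt0 _].
  rewrite -(sum_nat_dvd (f d) predT N d_gt0) /=.
  over.
rewrite (exchange_big_dep_nat predT) //=.
apply: eq_big_nat => k; rewrite ltnS => k_bnd.
rewrite (sum_divisors _ k_bnd).
by apply: eq_bigl => d; rewrite andbT.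
Qed.

End DivisorSums.

(** * The von Mangoldt and Moebius functions *)

Section Arithmetic.
Variable R : realType.

Definition mangoldt (n : nat) : R :=
  if size (primes n) == 1%N then ln (pdiv n)%:R else 0.

Lemma mangoldtX (p k : nat) : prime p -> (0 < k)%N -> mangoldt (p ^ k) = ln p%:R.
Proof.
case: k => // k p_pr _.
by rewrite /mangoldt primesX // primes_prime //= pdiv_pfactor.
Qed.

Lemma mangoldt_ge0 n : 0 <= mangoldt n.
Proof.
rewrite /mangoldt; case: ifP => // _.
by apply: ln_ge0; rewrite ler1n pdiv_gt0.
Qed.

Lemma mangoldt_neq0 n : mangoldt n != 0 ->
  exists p k : nat, [/\ prime p, (0 < k)%N & n = (p ^ k)%N].
Proof.
rewrite /mangoldt; case: ifP => [|_ /eqP//].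
case def_pr: (primes n) => [|p [|q s]] //= _ _.
have [p_pr n_gt0 p_n] : [/\ prime p, (0 < n)%N & (p %| n)%N].
  by apply/and3P; rewrite -mem_primes def_pr mem_head.
have /p_natP[k def_n] : p.-nat n by rewrite /pnat n_gt0 def_pr /= !inE eqxx.
exists p, k; split=> //; case: k def_n => // n1.
by move: p_n; rewrite n1 expn0 dvdn1 => /eqP p1; rewrite p1 in p_pr.
Qed.

(** Induction on [n], removing one factor [p := pdiv n]. Among the divisors of [n] that do not
    divide [n / p], only the full power of [p] in [n] has nonzero weight, and it adds [ln p]. *)
Lemma sum_mangoldt (n : nat) : (0 < n)%N ->
  \sum_(d <- divisors n) mangoldt d = ln n%:R.
Proof.
have [k] := ubnP n; elim: k n => // k IHk n; rewrite ltnS => le_nk n_gt0.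
have [n_gt1|n_le1] := ltnP 1 n; last first.
  have -> : n = 1%N by lia.
  by rewrite big_cons big_nil /mangoldt /= ln1 addr0.
set p := pdiv n; have p_pr : prime p by apply: pdiv_prime.
have /dvdnP[m def_n] : (p %| n)%N by apply: pdiv_dvd.
have m_gt0 : (0 < m)%N by move: n_gt0; rewrite def_n muln_gt0 => /andP[].
have p_gt1 := prime_gt1 p_pr; have p_gt0 := prime_gt0 p_pr.
have lt_mn : (m < n)%N by rewrite def_n; nia.
rewrite (@sum_divisors _ _ n n) ?n_gt0 ?leqnn // (bigID (fun d => d %| m)%N) /=.
rewrite (eq_bigl (fun d => d %| m)%N); last first.
  move=> d; apply/andP/idP => [[]//|d_m]; split=> //.
  by rewrite def_n dvdn_mulr.
rewrite -sum_divisors ?m_gt0 1?ltnW // IHk ?(leq_trans lt_mn) //.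
set e := (logn p m).+1.
have dvd_pe (j : nat) : ((p ^ j)%N %| m)%N = (j <= logn p m)%N.
  by rewrite pfactor_dvdn.
have dvd_pen (j : nat) : ((p ^ j)%N %| n)%N = (j <= e)%N.
  by rewrite pfactor_dvdn // def_n lognM // (logn_prime _ p_pr) eqxx addn1.
have le_pe : (p ^ e <= n)%N by rewrite dvdn_leq // dvd_pen.
rewrite big_mkcond (eq_big_nat _ _ (F2 := fun d => if d == (p ^ e)%N then mangoldt d else 0)).
  rewrite -big_mkcond big_nat1_eq expn_gt0 prime_gt0 //= ltnS le_pe mangoldtX //.
  by rewrite def_n natrM lnM ?posrE ?ltr0n.
move=> d _; case: eqP => [->|ne_d]; first by rewrite dvd_pe dvd_pen leqnn /e ltnn.
case: ifP => // /andP[d_n d_m].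
case: (eqVneq (mangoldt d) 0) => // /mangoldt_neq0 [q [j [q_pr j_gt0 def_d]]].
have [eq_qp|ne_qp] := eqVneq q p.
  move: d_n d_m ne_d; rewrite def_d eq_qp dvd_pe dvd_pen /e => ? ? [].
  by congr (_ ^ _)%N; lia.
case/negP: d_m; rewrite def_d in d_n *; move: d_n; rewrite def_n Gauss_dvdl //.
by rewrite coprimeXl // prime_coprime // dvdn_prime2.
Qed.

Definition moebius (n : nat) : R :=
  \prod_(p <- primes n) (if logn p n == 1%N then -1 else 0).

Lemma moebius_le1 n : `|moebius n| <= 1.
Proof.
rewrite normr_prod; elim/big_rec: _ => // p x _ x_le1.
by case: ifP; rewrite ?normrN1 ?mul1r // normr0 mul0r.
Qed.

Lemma moebius_primeM p d : prime p -> (0 < d)%N ->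
  moebius (p * d) = if (p %| d)%N then 0 else - moebius d.
Proof.
move=> p_pr d_gt0; have p_gt0 := prime_gt0 p_pr.
have pd_gt0 : (0 < p * d)%N by rewrite muln_gt0 p_gt0.
case: ifP => p_d.
  rewrite /moebius (big_rem p) /=; last first.
    by rewrite mem_primes p_pr pd_gt0 dvdn_mulr.
  rewrite lognM // (logn_prime _ p_pr) eqxx ifN ?mul0r //.
  by rewrite add1n eqSS -lt0n logn_gt0 mem_primes p_pr d_gt0.
have eq_primes : perm_eq (primes (p * d)) (p :: primes d).
  apply: uniq_perm; rewrite ?primes_uniq //= ?mem_primes ?p_d ?andbF ?primes_uniq //.
  by move=> q; rewrite primesM // inE primes_prime // inE.
rewrite /moebius (perm_big _ eq_primes) /=.
have p_d0 : logn p d = 0%N by rewrite lognE p_d !andbF.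
rewrite big_cons lognM // (logn_prime _ p_pr) eqxx p_d0 /= mulN1r.
  congr (- _); rewrite !big_seq; apply: eq_bigr => q q_d.
have /negbTE ne_qp : q != p.
  by apply: contraTneq q_d => ->; rewrite mem_primes p_d !andbF.
by rewrite lognM // (logn_prime _ p_pr) ne_qp.
Qed.

(** Let [p := pdiv n] and [n = m * p]. The divisors [p * j] contribute [- moebius j] when [p] does
    not divide [j], and 0 otherwise. They cancel the divisors prime to [p], which are exactly the
    divisors of [m] prime to [p]. *)
Lemma sum_moebius n : (0 < n)%N ->
  \sum_(d <- divisors n) moebius d = (n == 1%N)%:R.
Proof.
move=> n_gt0; have [n_gt1|n_le1] := ltnP 1 n; last first.
  have -> : n = 1%N by lia.
  by rewrite big_cons big_nil /moebius big_nil addr0.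
rewrite gtn_eqF //; set p := pdiv n; have p_pr : prime p by apply: pdiv_prime.
have /dvdnP[m def_n] : (p %| n)%N by apply: pdiv_dvd.
have m_gt0 : (0 < m)%N by move: n_gt0; rewrite def_n muln_gt0 => /andP[].
have p_gt0 := prime_gt0 p_pr.
rewrite (@sum_divisors _ _ n n) ?n_gt0 ?leqnn // (bigID (fun d => p %| d)%N) /=.
under eq_bigl do rewrite andbC.
rewrite sum_nat_dvd // def_n mulnK //.
have -> : \sum_(1 <= j < m.+1 | (p * j %| m * p)%N) moebius (p * j) =
    - \sum_(1 <= j < m.+1 | (j %| m)%N && ~~ (p %| j)%N) moebius j.
  rewrite -sumrN (eq_bigl (fun j => j %| m)%N); last first.
    by move=> j; rewrite mulnC dvdn_pmul2r.
  rewrite (bigID (fun j => p %| j)%N) /= big_nat_cond big1 ?add0r.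
    rewrite big_nat_cond [RHS]big_nat_cond.
    apply: eq_bigr => j /andP[/andP[j_gt0 _] /andP[_ /negbTE p_j]].
    by rewrite moebius_primeM // p_j.
  move=> j /andP[/andP[j_gt0 _] /andP[_ p_j]].
  by rewrite moebius_primeM // p_j.
apply/eqP; rewrite addrC subr_eq0; apply/eqP.
rewrite [RHS](@big_nat_widen _ _ _ 1 m.+1 (m * p).+1); last by rewrite ltnS leq_pmulr.
apply: eq_bigl => d; case: (boolP (p %| d)%N) => p_d; rewrite ?andbF //= !andbT ltnS.
rewrite Gauss_dvdl; last by rewrite coprime_sym prime_coprime.
by apply/idP/andP => [d_m|[]//]; split=> //; apply: dvdn_leq.
Qed.

Lemma sum_moebius_ln n : (0 < n)%N ->
  \sum_(d <- divisors n) moebius d * ln d%:R = - mangoldt n.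
Proof.
move=> n_gt0; have nn : (0 < n <= n)%N by rewrite n_gt0 leqnn.
have dvdM d e : ((d %| n) && (e %| n %/ d) = (d * e %| n))%N.
  case: (boolP (d %| n)%N) => /= [d_n|nd_n].
    by rewrite dvdn_divRL // mulnC.
  by apply/esym/negP => /(dvdn_trans (dvdn_mulr _ (dvdnn d))); apply/negP.
(* Here [ln (n / d) = ln n - ln d], and [ln n] times the Moebius sum vanishes for every [n], because
   [ln 1 = 0]. What remains is the Moebius inversion of [sum_mangoldt]. *)
suff : \sum_(d <- divisors n) moebius d * ln (n %/ d)%:R = mangoldt n.
  move=> <-; apply/eqP; rewrite -addr_eq0 -big_split /=; apply/eqP.
  rewrite big_seq (eq_bigr (fun d => moebius d * ln n%:R)).
    rewrite -big_seq -mulr_suml sum_moebius //.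
    by case: eqP => [->|]; rewrite ?ln1 ?mulr0 ?mul0r.
  move=> d; rewrite -dvdn_divisors // => d_n.
  rewrite -mulrDr -lnM ?posrE ?ltr0n ?divn_gt0 ?(dvdn_gt0 n_gt0 d_n) //.
    by rewrite -natrM mulnC divnK.
  exact: dvdn_leq.
rewrite (sum_divisors _ nn).
transitivity (\sum_(1 <= d < n.+1 | (d %| n)%N)
   \sum_(1 <= e < n.+1 | (e %| n %/ d)%N) moebius d * mangoldt e).
  rewrite big_nat_cond [RHS]big_nat_cond; apply: eq_bigr => d /andP[/andP[d_gt0 _] d_n].
  have nd_gt0 : (0 < n %/ d)%N by rewrite divn_gt0 // dvdn_leq.
  by rewrite -sum_mangoldt // mulr_sumr -sum_divisors // nd_gt0 leq_div.
rewrite (exchange_big_dep_nat (fun e => e %| n)%N) /=; last first.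
  by move=> d e _ _ d_n /dvdn_trans; apply; apply: dvdn_div.
transitivity (\sum_(1 <= e < n.+1 | (e %| n)%N) (n == e)%:R * mangoldt e).
  rewrite big_nat_cond [RHS]big_nat_cond; apply: eq_bigr => e /andP[/andP[e_gt0 _] e_n].
  have ne_gt0 : (0 < n %/ e)%N by rewrite divn_gt0 // dvdn_leq.
  rewrite -mulr_suml; congr (_ * _).
  have -> : (n == e) = (n %/ e == 1)%N by rewrite [RHS]eq_sym eqn_div // mul1n eq_sym.
  rewrite -sum_moebius // (sum_divisors _ (N := n)) ?ne_gt0 ?leq_div //.
  by apply: eq_bigl => d; rewrite dvdM mulnC -dvdM e_n.
rewrite -sum_divisors // (bigD1_seq n) ?divisors_id ?divisors_uniq //=.
rewrite eqxx mul1r big1 ?addr0 // => d; rewrite eq_sym => /negbTE ->.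
by rewrite mul0r.
Qed.

End Arithmetic.

(** * Selberg's formula *)

Section Selberg.
Variable R : realType.
Implicit Types x y : R.
Local Notation tr := (@Num.trunc R).
Local Notation mangoldt := (@mangoldt R).
Local Notation moebius := (@moebius R).

Lemma trunc_div x d : 0 <= x -> (0 < d)%N -> tr (x / d%:R) = (tr x %/ d)%N.
Proof.
move=> x_ge0 d_gt0; have xd_ge0 : 0 <= x / d%:R by rewrite divr_ge0.
have le_tr k : (k <= tr (x / d%:R))%N = (k <= tr x %/ d)%N.
  rewrite leq_divRL // !truncn_ge_nat // natrM.
  by rewrite ler_pdivlMr // ltr0n.
by apply/eqP; rewrite eqn_leq -le_tr leqnn le_tr leqnn.
Qed.

Lemma sum_hyperbola (V : nmodType) (f : nat -> nat -> V) (N : nat) :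
  \sum_(1 <= d < N.+1) \sum_(1 <= j < (N %/ d).+1) f d j =
  \sum_(1 <= j < N.+1) \sum_(1 <= d < (N %/ j).+1) f d j.
Proof.
have widen (g : nat -> V) d : (1 <= d < N.+1)%N ->
    \sum_(1 <= j < (N %/ d).+1) g j = \sum_(1 <= j < N.+1 | (j * d <= N)%N) g j.
  case/andP=> d_gt0 _; rewrite (@big_nat_widen _ _ _ 1 _ N.+1) ?ltnS ?leq_div //.
  by apply: eq_bigl => j; rewrite ltnS leq_divRL.
under eq_big_nat => d d_bnd do rewrite widen //.
under [RHS]eq_big_nat => d d_bnd do rewrite widen //.
rewrite (exchange_big_dep_nat predT) //=.
by apply: eq_bigr => d _; apply: eq_bigl => j; rewrite mulnC.
Qed.

Definition psi_nat (N : nat) : R := \sum_(1 <= k < N.+1) mangoldt k.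
Definition psi x := psi_nat (tr x).
Definition mertens x : R := \sum_(1 <= k < (tr x).+1) mangoldt k / k%:R.
(** The logarithm of the factorial of [N], the starting point of the estimates of Chebyshev and
    Mertens. *)
Definition sum_ln (N : nat) : R := \sum_(1 <= k < N.+1) ln k%:R.
Definition harmonic_sum (N : nat) : R := \sum_(1 <= k < N.+1) k%:R^-1.

Lemma psi_natS N : psi_nat N.+1 = psi_nat N + mangoldt N.+1.
Proof. by rewrite /psi_nat big_nat_recr. Qed.

Lemma sum_lnS N : sum_ln N.+1 = sum_ln N + ln N.+1%:R.
Proof. by rewrite /sum_ln big_nat_recr. Qed.

Lemma harmonic_sumS N : harmonic_sum N.+1 = harmonic_sum N + N.+1%:R^-1.
Proof. by rewrite /harmonic_sum big_nat_recr. Qed.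

Lemma psi_nat_ge0 N : 0 <= psi_nat N.
Proof. by apply: sumr_ge0 => k _; apply: mangoldt_ge0. Qed.

Lemma le_psi_nat : {homo psi_nat : m n / (m <= n)%N >-> m <= n}.
Proof.
apply: homo_leq => [x|y x z|n]; [exact: lexx | exact: le_trans |].
by rewrite psi_natS lerDl mangoldt_ge0.
Qed.

Lemma psi_ge0 x : 0 <= psi x.
Proof. exact: psi_nat_ge0. Qed.

Lemma le_psi : {homo psi : x y / x <= y}.
Proof. by move=> x y le_xy; apply/le_psi_nat/le_truncn. Qed.

Lemma sum_psi_div N :
  \sum_(1 <= n < N.+1) psi_nat (N %/ n) = sum_ln N.
Proof.
rewrite /psi_nat sum_hyperbola.
rewrite (sum_dvd_swap (fun j _ => mangoldt j)).
by apply: eq_big_nat => k /andP[k_gt0 _]; apply: sum_mangoldt.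
Qed.

Lemma sum_mangoldt_div N :
  \sum_(1 <= k < N.+1) mangoldt k * (N %/ k)%:R = sum_ln N.
Proof.
rewrite -sum_psi_div /psi_nat sum_hyperbola; apply: eq_bigr => k _.
by rewrite sumr_const_nat subSS subn0 mulr_natr.
Qed.

Lemma lnS_bounds (K : nat) : (0 < K)%N ->
  K.+1%:R^-1 <= ln K.+1%:R - ln K%:R :> R /\ ln K.+1%:R - ln K%:R <= K%:R^-1 :> R.
Proof.
move=> K_gt0; have K_gt0' : 0 < K%:R :> R by rewrite ltr0n.
have S_gt0 : 0 < K.+1%:R :> R by rewrite ltr0n.
have defS : K.+1%:R = K%:R + 1 :> R by rewrite -addn1 natrD.
split.
  have -> : ln K.+1%:R - ln K%:R = - ln (1 - K.+1%:R^-1) :> R.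
    rewrite -opprB -ln_div ?posrE //; congr (- ln _).
    by rewrite defS; field; lra.
  rewrite lerNr; apply: le_ln1Dx.
  by rewrite ltrN2 invf_lt1 // defS; lra.
rewrite -ln_div ?posrE //.
have -> : K.+1%:R / K%:R = 1 + K%:R^-1 :> R by rewrite defS; field; lra.
apply: le_ln1Dx; apply: (lt_trans (y := 0)); first by lra.
by rewrite invr_gt0.
Qed.

Lemma sum_ln_bounds (N : nat) : (0 < N)%N ->
  N%:R * ln N%:R - N%:R <= sum_ln N :> R /\ sum_ln N <= N%:R * ln N%:R :> R.
Proof.
elim: N => // -[_ _|N IHN _].
  by rewrite /sum_ln big_nat1 ln1 mulr0; split; lra.
have [lb ub] := IHN isT; rewrite sum_lnS.
have [_ l2] := @lnS_bounds N.+1 isT.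
have l1 : ln N.+1%:R <= ln N.+2%:R :> R.
  by rewrite ler_ln ?posrE ?ltr0n // ler_nat.
have N_gt0 : 0 < N.+1%:R :> R by rewrite ltr0n.
have l3 : N.+1%:R * (ln N.+2%:R - ln N.+1%:R) <= 1 :> R.
  by rewrite mulrC -ler_pdivlMr // div1r.
move: l1 l2 l3; move: (ln N.+2%:R) => L l1 l2 l3; rewrite -[N.+2%:R]natr1; split; nra.
Qed.

Lemma ln_le_id x : 0 < x -> ln x <= x.
Proof. by move=> x_gt0; apply/ltW/ln_sublinear. Qed.

(* Compare [sum_ln N - 2 sum_ln (N %/ 2)], as in Chebyshev's estimate. *)
Lemma psi_half N : psi_nat N <= psi_nat (N %/ 2) + 4 * N%:R.
Proof.
set h := (N %/ 2)%N.
have ub : psi_nat N - psi_nat h <= sum_ln N - 2 * sum_ln h.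
  have le_hN : (h <= N)%N by rewrite leq_div.
  have widen (F : nat -> R) : (forall k, (h < k)%N -> F k = 0) ->
      \sum_(1 <= k < h.+1) F k = \sum_(1 <= k < N.+1) F k.
    move=> F0; rewrite (@big_cat_nat _ _ _ h.+1 1 N.+1) //=.
    rewrite [X in _ + X]big1_seq ?addr0 // => k /andP[_].
    by rewrite mem_index_iota => /andP[/F0].
  have -> : psi_nat h = \sum_(1 <= k < N.+1) (k <= h)%N%:R * mangoldt k.
    rewrite -widen => [|k lt_hk]; last by rewrite leqNgt lt_hk mul0r.
    by apply: eq_big_nat => k /andP[_]; rewrite ltnS => ->; rewrite mul1r.
  rewrite -!sum_mangoldt_div /psi_nat (widen (fun k => _ * _)); last first.
    by move=> k lt_hk; rewrite divn_small // mulr0.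
  rewrite mulr_sumr -!sumrB; apply: ler_sum_nat => k /andP[k_gt0]; rewrite ltnS => le_kN.
  have -> : mangoldt k - (k <= h)%N%:R * mangoldt k = mangoldt k * (h < k)%N%:R.
    by rewrite ltnNge; case: (k <= h)%N => /=; ring.
  have -> : mangoldt k * (N %/ k)%:R - 2 * (mangoldt k * (h %/ k)%:R) =
     mangoldt k * ((N %/ k)%:R - (2 * (h %/ k))%:R) by rewrite natrM; ring.
  apply: ler_wpM2l; first exact: mangoldt_ge0.
  (* The coefficient of [mangoldt k] is thus the remainder of [N %/ k] modulo 2, hence nonnegative;
     for [h < k <= N] the quotient [h %/ k] is 0 and the coefficient is at least 1. *)
  have -> : (h %/ k = (N %/ k) %/ 2)%N by rewrite /h -!divnMA mulnC.
  rewrite lerBrDr -natrD ler_nat.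
  case: ltnP => [lt_hk|_]; last by rewrite add0n mulnC leq_divM.
  have : (N %/ k %/ 2 = 0)%N by rewrite -divnMA mulnC divnMA divn_small.
  by move=> ->; rewrite divn_gt0.
have [h0|h_gt0] := posnP h.
  have : (N <= 1)%N by move: h0; rewrite /h; lia.
  case: N @h ub h0 => [|[|//]] h ub h0 _.
    by rewrite mulr0 addr0 /h.
  rewrite psi_natS /mangoldt /= !addr0; apply: (@le_trans _ _ (psi_nat h)).
    exact: le_psi_nat.
  by rewrite lerDl mulr1.
have h_gt0' : 0 < h%:R :> R by rewrite ltr0n.
have h_ge1 : 1 <= h%:R :> R by rewrite ler1n.
have leN : N%:R <= 2 * h%:R + 1 :> R.
  by rewrite -natrM natr1 ler_nat /h; lia.
have geN : 2 * h%:R <= N%:R :> R by rewrite -natrM ler_nat /h; lia.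
have N_gt0 : (0 < N)%N by rewrite /h in h_gt0; lia.
have [lb _] := sum_ln_bounds h_gt0; have [_ ubN] := sum_ln_bounds N_gt0.
have lnN : ln N%:R <= ln h%:R + 2 :> R.
  have -> : N%:R = h%:R * (N%:R / h%:R) :> R by field; lra.
  rewrite lnM ?posrE ?divr_gt0 ?ltr0n // lerD2l.
  have q_le3 : N%:R / h%:R <= 3 :> R by rewrite ler_pdivrMr //; lra.
  have -> : N%:R / h%:R = 1 + (N%:R / h%:R - 1) :> R by ring.
  apply: (le_trans (le_ln1Dx _)); last by lra.
  have : 0 < N%:R / h%:R :> R by rewrite divr_gt0 ?ltr0n.
  by lra.
have lnh : ln h%:R <= h%:R :> R by apply: ln_le_id.
have lnh0 : 0 <= ln h%:R :> R by apply: ln_ge0.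
nra.
Qed.

(** Chebyshev's bound: iterating [psi_half] sums a geometric series of ratio 1/2, so the constant 4
    doubles. *)
Lemma psi_nat_le N : psi_nat N <= 8 * N%:R.
Proof.
have [k] := ubnP N; elim: k N => // k IHk N; rewrite ltnS => le_Nk.
have [->|N_gt0] := posnP N; first by rewrite /psi_nat big_geq // mulr0.
have : psi_nat (N %/ 2) <= 8 * (N %/ 2)%:R by apply: IHk; lia.
have := psi_half N.
have : 2 * (N %/ 2)%:R <= N%:R :> R by rewrite -natrM ler_nat; lia.
lra.
Qed.

Lemma psi_le x : 0 <= x -> psi x <= 8 * x.
Proof.
move=> x_ge0; apply: (le_trans (psi_nat_le _)).
by apply: ler_wpM2l => //; rewrite truncn_le.
Qed.

Lemma trunc_gt0 x : 1 <= x -> 0 < (tr x)%:R :> R.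
Proof. by move=> x_ge1; rewrite ltr0n truncn_gt0. Qed.

Lemma ln_trunc x : 1 <= x -> ln (tr x)%:R <= ln x /\ ln x <= ln (tr x)%:R + 1.
Proof.
move=> x_ge1; have t_gt0 := trunc_gt0 x_ge1.
have x_gt0 : 0 < x by lra.
have t_ge1 : (0 < tr x)%N by rewrite truncn_gt0.
split; first by rewrite ler_ln ?posrE // truncn_le ltW.
have [_ l2] := lnS_bounds t_ge1.
have : ln x <= ln (tr x).+1%:R.
  by rewrite ler_ln ?posrE ?ltr0n // ltW // truncnS_gt.
have : (tr x)%:R^-1 <= 1 :> R by rewrite invf_le1 // ler1n.
lra.
Qed.

(** In [sum_mangoldt_div], replacing [N %/ k] by [N / k] changes the sum by at most [psi_nat N],
    which is [O(N)] by Chebyshev's bound; dividing by [N] and applying [sum_ln_bounds] gives the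
    estimate. *)
Lemma mertens_bounds x : 1 <= x -> ln x - 8 <= mertens x <= ln x + 8.
Proof.
move=> x_ge1; have t_gt0 := trunc_gt0 x_ge1.
have t_ge1 : (0 < tr x)%N by rewrite truncn_gt0.
have [l1 l2] := ln_trunc x_ge1.
have [lb ub] := sum_ln_bounds t_ge1.
have up : sum_ln (tr x) <= (tr x)%:R * mertens x.
  rewrite -sum_mangoldt_div mulr_sumr; apply: ler_sum_nat => k /andP[k_gt0 _].
  rewrite mulrCA; apply: ler_wpM2l; first exact: mangoldt_ge0.
  by rewrite ler_pdivlMr ?ltr0n // -natrM ler_nat leq_divM.
have down : (tr x)%:R * mertens x <= sum_ln (tr x) + psi_nat (tr x).
  rewrite -sum_mangoldt_div mulr_sumr -big_split /=.
  apply: ler_sum_nat => k /andP[k_gt0 _].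
  rewrite -[X in _ + X]mulr1 -mulrDr mulrCA; apply: ler_wpM2l; first exact: mangoldt_ge0.
  by rewrite ler_pdivrMr ?ltr0n // natr1 -natrM ler_nat ltnW // ltn_ceil.
have := psi_nat_le (tr x).
move: lb ub up down t_gt0 l1 l2; move: (ln (tr x)%:R) (sum_ln _) (psi_nat _) (mertens x).
move: (ln x) => L l T P M; move: (tr x)%:R => t lb ub up down t_gt0 l1 l2 Pt.
have t1 : t * (l - 1) <= t * M by lra.
have t2 : t * M <= t * (l + 8) by lra.
by move: t1 t2; rewrite !ler_pM2l // => t1 t2; apply/andP; split; lra.
Qed.

(* [euler_diff N] plays the role of Euler's constant below, with an explicit error and no limit. *)
Definition euler_diff (K : nat) : R := harmonic_sum K - ln K%:R.

Lemma euler_diff_bounds (K N : nat) : (0 < K <= N)%N ->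
  0 <= euler_diff K - euler_diff N /\
  euler_diff K - euler_diff N <= K%:R^-1 - N%:R^-1.
Proof.
case/andP=> K_gt0 /subnKC <-; elim: (N - K)%N => [|i [lb ub]].
  by rewrite addn0 !subrr.
have m_gt0 : (0 < K + i)%N by rewrite addn_gt0 K_gt0.
rewrite addnS; move: (K + i)%N m_gt0 lb ub => m m_gt0.
have [] := lnS_bounds m_gt0; rewrite /euler_diff harmonic_sumS.
by move: (m.+1%:R^-1) (m%:R^-1) (K%:R^-1) => u v w l1 l2 lb ub; split; lra.
Qed.

Lemma euler_diff1 : euler_diff 1 = 1.
Proof. by rewrite /euler_diff /harmonic_sum big_nat1 ln1 subr0 invr1. Qed.

Lemma euler_diff_itv (N : nat) : (0 < N)%N -> 0 <= euler_diff N <= 1.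
Proof.
move=> N_gt0; have [|lb ub] := @euler_diff_bounds 1 N; first by rewrite N_gt0.
have N_ge0 : 0 <= N%:R^-1 :> R by rewrite invr_ge0.
rewrite euler_diff1 invr1 in lb ub.
by move: (N%:R^-1) N_ge0 ub => u N_ge0 ub; apply/andP; split; lra.
Qed.

Lemma harmonic_sum_le (N : nat) : (0 < N)%N -> harmonic_sum N <= 1 + ln N%:R.
Proof. by move=> /euler_diff_itv /andP[]; rewrite /euler_diff => *; lra. Qed.

(** From [K] to [K + 1] the expression changes by [ln (K + 1) - ln K] minus
    [euler_diff K - euler_diff N]. Both quantities lie between 0 and [1 / K], so the change is at
    most [2 / (K + 1)] in absolute value, which the growth of [2 * harmonic_sum K] pays for. *)
Lemma sum_ln_harmonic_sum (K N : nat) : (0 < K <= N)%N ->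
  `|sum_ln K - K%:R * harmonic_sum K + (euler_diff N + 1) * K%:R| <= 1 + 2 * harmonic_sum K.
Proof.
elim: K => // -[_|K IHK] /= lt_KN.
  rewrite /sum_ln /harmonic_sum !big_nat1 ln1 invr1 !mulr1.
  have /andP[? ?] := euler_diff_itv lt_KN.
  by rewrite ler_norml; apply/andP; split; lra.
have {IHK} := IHK (ltnW lt_KN); rewrite !ler_norml => /andP[IH1 IH2].
have [|lb ub] := @euler_diff_bounds K.+1 N; first exact: ltnW.
have [l1 l2] := @lnS_bounds K.+1 isT.
have N_ge0 : 0 <= N%:R^-1 :> R by rewrite invr_ge0.
have K2_ge0 : 0 < K.+2%:R^-1 :> R by rewrite invr_gt0 ltr0n.
have K2V : K.+2%:R * K.+2%:R^-1 = 1 :> R by rewrite mulfV // pnatr_eq0.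
rewrite sum_lnS harmonic_sumS; set H := harmonic_sum K.+1 in IH1 IH2 lb ub *.
rewrite -[euler_diff K.+1]/(H - ln K.+1%:R) in lb ub; set g := euler_diff N in IH1 IH2 lb ub *.
have -> : sum_ln K.+1 + ln K.+2%:R - K.+2%:R * (H + K.+2%:R^-1) + (g + 1) * K.+2%:R
  = (sum_ln K.+1 - K.+1%:R * H + (g + 1) * K.+1%:R) + (ln K.+2%:R - H + g).
  by rewrite mulrDr K2V; move: (ln K.+2%:R) => L; rewrite -[K.+2%:R]natr1; ring.
have lK : K.+1%:R^-1 <= 2 * K.+2%:R^-1 :> R.
  rewrite -div1r ler_pdivrMr ?ltr0n // mulrAC ler_pdivlMr ?ltr0n //.
  by rewrite mul1r -natrM ler_nat; lia.
move: (N%:R^-1) (K.+1%:R^-1) (K.+2%:R^-1) N_ge0 K2_ge0 ub l1 l2 lK {K2V} => u v w.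
by move=> *; apply/andP; split; lra.
Qed.

(** The function [psi y - y + euler_diff N + 1] is chosen so that the terms of order [y * ln y] and
    [y] cancel in this sum. The constant depends on [N], not on [y], since one function must serve
    for all arguments [y = x / d]. *)
Lemma sum_psi_error y N : 1 <= y -> (tr y <= N)%N ->
  `|\sum_(1 <= n < (tr y).+1) (psi (y / n%:R) - y / n%:R + euler_diff N + 1)|
    <= 4 + 3 * ln y.
Proof.
move=> y_ge1 le_yN; have y_ge0 : 0 <= y by lra.
have K_gt0 : (0 < tr y)%N by rewrite truncn_gt0.
have -> : \sum_(1 <= n < (tr y).+1) (psi (y / n%:R) - y / n%:R + euler_diff N + 1)
   = sum_ln (tr y) - y * harmonic_sum (tr y) + (euler_diff N + 1) * (tr y)%:R.
  under eq_bigr do rewrite -addrA.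
  rewrite big_split /= sumrB -mulr_sumr sumr_const_nat subSS subn0 mulr_natr.
  congr (_ - _ + _); rewrite -sum_psi_div; apply: eq_big_nat => n /andP[n_gt0 _].
  by rewrite /psi trunc_div.
have [l1 l2] := ln_trunc y_ge1.
have := @sum_ln_harmonic_sum (tr y) N; rewrite K_gt0 le_yN => /(_ isT).
have := harmonic_sum_le K_gt0.
have /andP[tr1 tr2] := truncn_itv y_ge0.
have : 0 <= harmonic_sum (tr y) by apply: sumr_ge0 => k _; rewrite invr_ge0.
rewrite -natr1 in tr2.
move: (harmonic_sum _) (sum_ln _) => H T H_ge0 H_le; rewrite !ler_norml => /andP[lb ub].
by apply/andP; split; nra.
Qed.

Lemma sum_rsqrt N : \sum_(1 <= d < N.+1) (Num.sqrt d%:R)^-1 <= 2 * Num.sqrt N%:R :> R.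
Proof.
elim: N => [|N IHN]; first by rewrite big_geq // sqrtr0 mulr0.
rewrite big_nat_recr //=; apply: (le_trans (lerD IHN (lexx _))).
set a := Num.sqrt N%:R; set b := Num.sqrt N.+1%:R.
have a_ge0 : 0 <= a by apply: sqrtr_ge0.
have b_gt0 : 0 < b by rewrite sqrtr_gt0 ltr0n.
have a2 : a ^+ 2 = N%:R by rewrite sqr_sqrtr.
have b2 : b ^+ 2 = N%:R + 1 by rewrite sqr_sqrtr // natr1.
have le_ab : a <= b by rewrite ler_wsqrtr // ler_nat.
rewrite -lerBrDl -div1r ler_pdivrMr //; nra.
Qed.

(** With [s] the fourth root of [y], [ln y = 4 ln s] and [ln s <= s], so the left side is at most
    [16 s + 48 s ^+ 2], hence at most [64 s ^+ 2] because [s >= 1]. *)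
Lemma ln_sqr_le y : 1 <= y -> ln y * (4 + 3 * ln y) <= 64 * Num.sqrt y.
Proof.
move=> y_ge1; have y_gt0 : 0 < y by lra.
set s := Num.sqrt (Num.sqrt y).
have s_ge1 : 1 <= s.
  by rewrite -[1]sqrtr1 ler_wsqrtr // -[1]sqrtr1 ler_wsqrtr.
have s2 : Num.sqrt y = s ^+ 2 by rewrite sqr_sqrtr // sqrtr_ge0.
have s4 : y = s ^+ 4 by rewrite -[4%N]/(2 * 2)%N exprM -s2 sqr_sqrtr // ltW.
have ln_y : ln y = 4 * ln s by rewrite {1}s4 lnXn ?mulr_natl //; lra.
have : ln s <= s by apply: ln_le_id; lra.
have : 0 <= ln s by apply: ln_ge0.
by rewrite ln_y s2; nra.
Qed.

(* The Tatuzawa-Iseki inversion: a sum of [F (x / k)] twisted by [moebius] and a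
   logarithm reproduces the two terms of Selberg's formula. *)
Lemma tatuzawa_iseki x (F : R -> R) : 1 <= x ->
  \sum_(1 <= d < (tr x).+1) moebius d * ln (x / d%:R) *
    \sum_(1 <= j < (tr x %/ d).+1) F (x / d%:R / j%:R) =
  F x * ln x + \sum_(1 <= k < (tr x).+1) mangoldt k * F (x / k%:R).
Proof.
move=> x_ge1; have x_gt0 : 0 < x by lra.
have N_gt0 : (0 < tr x)%N by rewrite truncn_gt0.
under eq_bigr => d _.
  rewrite mulr_sumr.
  under eq_bigr => j _ do rewrite -[x / _ / _]mulrA -invfM -natrM.
  over.
rewrite (sum_dvd_swap (fun d k => moebius d * ln (x / d%:R) * F (x / k%:R))).
transitivity (\sum_(1 <= k < (tr x).+1)
    ((k == 1%N)%:R * ln x * F (x / k%:R) + mangoldt k * F (x / k%:R))).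
  apply: eq_big_nat => k /andP[k_gt0 _].
  (* With [ln (x / d) = ln x - ln d], the first term leaves only [k = 1] by [sum_moebius], and the
     second leaves [mangoldt k] by [sum_moebius_ln]. *)
  rewrite -mulr_suml -mulrDl; congr (_ * _).
  rewrite -sum_moebius // -[mangoldt k]opprK -sum_moebius_ln // mulr_suml -sumrB.
  rewrite big_seq [RHS]big_seq; apply: eq_bigr => d; rewrite -dvdn_divisors // => d_k.
  by rewrite -mulrBr ln_div // posrE // ltr0n (dvdn_gt0 k_gt0 d_k).
rewrite big_split /=; congr (_ + _).
rewrite big_ltn // big_nat big1 ?addr0 => [|k /andP[k_gt1 _]].
  by rewrite eqxx mul1r divr1 mulrC.
by rewrite gtn_eqF // !mul0r.
Qed.

Definition selberg_sum x := psi x * ln x +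
  \sum_(1 <= k < (tr x).+1) mangoldt k * psi (x / k%:R).

(** The inversion is applied to the function of [sum_psi_error]. The twisted side is at most the sum
    of [64 * sqrt (x / d)], hence [128 x]. The other side differs from the wanted one by a Mertens
    error of at most [8 x] and by [(g + 1) * (ln x + psi x)], at most [18 x]; together these make
    154. *)
Theorem selberg_formula x : 1 <= x ->
  `|selberg_sum x - 2 * x * ln x| <= 154 * x.
Proof.
move=> x_ge1; have x_gt0 : 0 < x by lra.
have x_ge0 := ltW x_gt0.
have N_gt0 : (0 < tr x)%N by rewrite truncn_gt0.
set g := euler_diff (tr x).
have := tatuzawa_iseki (fun y => psi y - y + g + 1) x_ge1.
set S := (X in X = _) => eqS.
have S_le : `|S| <= 128 * x.
  apply: (le_trans (ler_norm_sum _ _ _)).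
  apply: (@le_trans _ _ (\sum_(1 <= d < (tr x).+1) 64 * Num.sqrt x * (Num.sqrt d%:R)^-1)).
    apply: ler_sum_nat => d /andP[d_gt0]; rewrite ltnS => le_dx.
    have d_gt0' : 0 < d%:R :> R by rewrite ltr0n.
    have y_ge1 : 1 <= x / d%:R.
      by rewrite ler_pdivlMr // mul1r -truncn_ge_nat.
    have ln_y : 0 <= ln (x / d%:R) by apply: ln_ge0.
    rewrite normrM -trunc_div //.
    apply: (@le_trans _ _ (ln (x / d%:R) * (4 + 3 * ln (x / d%:R)))).
      apply: ler_pM => //.
        by rewrite normrM (ger0_norm ln_y) ler_piMl // moebius_le1.
      by apply: sum_psi_error; rewrite ?trunc_div // leq_div.
    apply: (le_trans (ln_sqr_le y_ge1)).
    by rewrite -mulrA -sqrtrV // -sqrtrM.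
  rewrite -mulr_sumr.
  have := sum_rsqrt (tr x); set Q := \sum_(_ <= _ < _) _ => Q_le.
  have sx_gt0 : 0 < Num.sqrt x by rewrite sqrtr_gt0.
  have st : Num.sqrt (tr x)%:R <= Num.sqrt x by rewrite ler_wsqrtr // truncn_le.
  have sx2 : Num.sqrt x ^+ 2 = x by rewrite sqr_sqrtr.
  nra.
have defR : S = selberg_sum x - 2 * x * ln x
    - x * (mertens x - ln x) + (g + 1) * (ln x + psi x).
  rewrite eqS /selberg_sum /mertens /psi /psi_nat -/(psi_nat _) -/(psi _).
  under eq_bigr => k _.
    have -> : mangoldt k * (psi (x / k%:R) - x / k%:R + g + 1) =
      mangoldt k * psi (x / k%:R) - x * (mangoldt k / k%:R) + (g + 1) * mangoldt k.
      by ring.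
    over.
  rewrite big_split /= sumrB -!mulr_sumr -/(psi_nat _) -/(psi _); ring.
have := psi_le x_ge0; have := psi_ge0 x.
have := mertens_bounds x_ge1; have := ln_le_id x_gt0; have := ln_ge0 x_ge1.
have := euler_diff_itv N_gt0; rewrite -/g.
move: S_le; rewrite defR !ler_norml.
move: (selberg_sum x - 2 * x * ln x) (psi x) (mertens x) (ln x) (g : R).
move=> {S eqS defR g} B P M L g.
by move=> ? ? ? ? ? ? ?; apply/andP; split; nra.
Qed.

End Selberg.

(** * Consequences of Selberg's formula for short intervals *)

Section Gaps.
Variable R : realType.
Implicit Types x y a b t Z W : R.
Local Notation tr := (@Num.trunc R).
Local Notation mangoldt := (@mangoldt R).

Lemma mulr_ln_diff_le x y : 0 < x -> 0 < y -> x * (ln y - ln x) <= y - x.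
Proof.
move=> x_gt0 y_gt0; rewrite -ln_div ?posrE // mulrC -ler_pdivlMr //.
have -> : y / x = 1 + (y - x) / x by field; lra.
apply: le_ln1Dx; rewrite ltr_pdivlMr //; lra.
Qed.

Lemma sum_trunc_diff (f : nat -> R) a b : a <= b ->
  \sum_(1 <= k < (tr b).+1) f k - \sum_(1 <= k < (tr a).+1) f k =
  \sum_((tr a).+1 <= k < (tr b).+1) f k.
Proof.
move=> le_ab; rewrite (@big_cat_nat _ _ _ (tr a).+1 1 (tr b).+1) //=.
  by rewrite addrAC subrr add0r.
by rewrite ltnS le_truncn.
Qed.

Lemma mem_trunc_itv a b k : 0 <= a -> 0 <= b ->
  ((tr a).+1 <= k < (tr b).+1)%N = (a < k%:R <= b).
Proof. by move=> a_ge0 b_ge0; rewrite truncn_lt_nat // ltnS truncn_ge_nat. Qed.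

Lemma mertens_diff a b : a <= b -> mertens b - mertens a =
  \sum_((tr a).+1 <= k < (tr b).+1) mangoldt k / k%:R.
Proof. exact: sum_trunc_diff. Qed.

Lemma weight_ge0 k : 0 <= mangoldt k / k%:R.
Proof. by rewrite divr_ge0 ?mangoldt_ge0. Qed.

Lemma le_mertens : {homo (@mertens R) : x y / x <= y}.
Proof.
move=> x y le_xy; rewrite -subr_ge0 mertens_diff //.
by apply: sumr_ge0 => k _; apply: weight_ge0.
Qed.

Lemma psi_mertens_diff a b : 0 <= a <= b ->
  psi b - psi a <= b * (mertens b - mertens a).
Proof.
move=> /andP[a_ge0 le_ab]; have b_ge0 := le_trans a_ge0 le_ab.
rewrite mertens_diff // /psi /psi_nat sum_trunc_diff // mulr_sumr.
apply: ler_sum_nat => k; rewrite mem_trunc_itv // => /andP[lt_ak le_kb].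
rewrite mulrCA ler_peMr ?mangoldt_ge0 // ler_pdivlMr ?mul1r //.
exact: le_lt_trans lt_ak.
Qed.

Lemma sum_window_le a b N (P : pred nat) : 0 <= a <= b ->
  (forall k, P k -> a < k%:R <= b) ->
  \sum_(1 <= k < N.+1 | P k) mangoldt k / k%:R <= mertens b - mertens a.
Proof.
move=> /andP[a_ge0 le_ab] Pab; have b_ge0 := le_trans a_ge0 le_ab.
rewrite mertens_diff //.
have w_ge0 k : 0 <= (P k)%:R * (mangoldt k / k%:R).
  by rewrite mulr_ge0 // weight_ge0.
apply: (@le_trans _ _ (\sum_(1 <= k < (maxn N (tr b)).+1) (P k)%:R * (mangoldt k / k%:R))).
  rewrite big_mkcond (@big_cat_nat _ _ _ N.+1 1 (maxn N (tr b)).+1) //= ?ltnS ?leq_maxl //.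
  rewrite -[X in X <= _]addr0; apply: lerD; last by apply: sumr_ge0 => k _; apply: w_ge0.
  by apply: ler_sum => k _; case: (P k); rewrite ?mul1r ?mul0r.
have -> : \sum_((tr a).+1 <= k < (tr b).+1) mangoldt k / k%:R =
    \sum_(1 <= k < (maxn N (tr b)).+1 | (a < k%:R <= b)) mangoldt k / k%:R.
  rewrite (@big_nat_widenl _ _ _ _ 1) //.
  rewrite (@big_nat_widen _ _ _ 1 (tr b).+1 (maxn N (tr b)).+1) ?ltnS ?leq_maxr //=.
  by apply: eq_bigl => k; rewrite mem_trunc_itv.
rewrite [X in _ <= X]big_mkcond /=; apply: ler_sum => k _.
have := Pab k; case: (P k) => [/(_ isT) ->|_]; first by rewrite mul1r.
by rewrite mul0r; case: ifP => // _; apply: weight_ge0.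
Qed.

Lemma sum_window_le_ln a b N (P : pred nat) : 0 < a <= b ->
  (forall k, P k -> a <= k%:R <= b) ->
  \sum_(1 <= k < N.+1 | P k) mangoldt k / k%:R <= ln (b / a) + 17.
Proof.
move=> /andP[a_gt0 le_ab] Pab; have b_gt0 := lt_le_trans a_gt0 le_ab.
have ln2_le1 : ln 2 <= 1 :> R by apply: (@le_ln1Dx R 1); lra.
have ln_ba : 0 <= ln (b / a) by apply: ln_ge0; rewrite ler_pdivlMr ?mul1r.
have [b_lt1|b_ge1] := ltP b 1.
  rewrite big_nat_cond big1 ?addr_ge0 // => k /andP[/andP[k_gt0 _] /Pab/andP[_ le_kb]].
  have : 1 <= k%:R :> R by rewrite ler1n.
  lra.
have /andP[_ ub] := mertens_bounds b_ge1; rewrite ln_div ?posrE //.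
(* The window is closed, whereas a difference of [mertens] omits its left end. Starting at [a / 2],
   or at 0 for small [a], costs [ln 2 <= 1]; with the two Mertens errors 8 this gives 17. *)
have [a_lt2|a_ge2] := ltP a 2.
  have ln_a : ln a <= ln 2 by rewrite ler_ln ?posrE //; lra.
  apply: (@le_trans _ _ (mertens b - mertens 0)).
    apply: sum_window_le => [|k /Pab/andP[le_ak ->]]; first by rewrite lexx ltW.
    by rewrite andbT; lra.
  have : 0 <= mertens 0 :> R by apply: sumr_ge0 => k _; apply: weight_ge0.
  lra.
apply: (@le_trans _ _ (mertens b - mertens (a / 2))).
  apply: sum_window_le => [|k /Pab/andP[le_ak ->]]; first by apply/andP; split; lra.
  by rewrite andbT; lra.
have /andP[lb _] : ln (a / 2) - 8 <= mertens (a / 2) <= ln (a / 2) + 8.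
  by apply: mertens_bounds; lra.
rewrite ln_div ?posrE // in lb; lra.
Qed.

Lemma le_sum_mangoldt_psi x y : 0 <= x <= y ->
  \sum_(1 <= k < (tr x).+1) mangoldt k * psi (x / k%:R) <=
  \sum_(1 <= k < (tr y).+1) mangoldt k * psi (y / k%:R).
Proof.
move=> /andP[x_ge0 le_xy].
rewrite (@big_cat_nat _ _ _ (tr x).+1 1 (tr y).+1) //= ?ltnS ?le_truncn //.
rewrite -[X in X <= _]addr0; apply: lerD; last first.
  by apply: sumr_ge0 => k _; rewrite mulr_ge0 ?mangoldt_ge0 ?psi_ge0.
apply: ler_sum => k _; rewrite ler_wpM2l ?mangoldt_ge0 // le_psi //.
by rewrite ler_wpM2r ?invr_ge0.
Qed.

(* The second sum in Selberg's formula is monotone, which leaves a bound of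
   Brun-Titchmarsh type with the constant 2. *)
Lemma psi_diff_ln x y : 1 <= x <= y ->
  (psi y - psi x) * ln y <= 2 * (y - x) * ln y + 310 * y.
Proof.
move=> /andP[x_ge1 le_xy]; have y_ge1 := le_trans x_ge1 le_xy.
have := selberg_formula y_ge1; have := selberg_formula x_ge1.
rewrite !ler_norml /selberg_sum => /andP[lbx _] /andP[_ uby].
have le_sums := @le_sum_mangoldt_psi x y.
have /le_sums {}le_sums : 0 <= x <= y by rewrite le_xy andbT; lra.
(* This replaces [2 x ln x] by [2 x ln y] at the cost of [2 (y - x)]; the two Selberg errors are at
   most [154 y] each, so the total is at most [310 y]. *)
have : x * (ln y - ln x) <= y - x by apply: mulr_ln_diff_le; lra.
have : ln x <= ln y by rewrite ler_ln ?posrE //; lra.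
have : 0 <= psi x by apply: psi_ge0.
move: lbx uby le_sums; do 2 move: (\sum_(_ <= _ < _) _) => ?.
move: (psi x) (psi y) (ln x) (ln y) => px py lx ly *.
have : px * lx <= px * ly by rewrite ler_wpM2l.
lra.
Qed.

Lemma psi_diff_le (e : R) : 0 < e -> exists2 Y : R, 1 <= Y &
  forall x y, Y <= x -> x <= y <= 3 * x -> psi y - psi x <= 2 * (y - x) + e * x.
Proof.
move=> e_gt0.
have [C C_gt0 HC] : exists2 C : R, 0 < C & forall x y, 1 <= x <= y ->
    (psi y - psi x) * ln y <= 2 * (y - x) * ln y + C * y.
  by exists 310; [rewrite ltr0n | exact: psi_diff_ln].
have Ce_gt0 : 0 < 3 * C / e by rewrite divr_gt0 // mulr_gt0.
have E_ge1 : 1 <= expR (3 * C / e).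
  by rewrite -[X in X <= _]expR0 ler_expR ltW.
(* From here on [3 * C <= e * ln y], so that the error [C * y], at most [3 * C * x], is at most
   [e * x] after division by [ln y]. *)
exists (expR (3 * C / e)) => // x y le_Yx /andP[le_xy le_y3x].
have x_ge1 := le_trans E_ge1 le_Yx.
have := HC x y; rewrite x_ge1 le_xy => /(_ isT) main.
have ln_y : 3 * C / e <= ln y.
  rewrite -[X in X <= _]expRK ler_ln ?posrE ?expR_gt0 ?(le_trans le_Yx) //; lra.
have ln_y_gt0 : 0 < ln y by apply: lt_le_trans ln_y.
rewrite ler_pdivrMr // in ln_y.
have h : 3 * C * x <= ln y * e * x by rewrite ler_wpM2r //; lra.
have h' : C * y <= C * (3 * x) by rewrite ler_pM2l.
rewrite -(ler_pM2r ln_y_gt0); lra.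
Qed.

Definition saturated (lam c : R) x (k : nat) : bool :=
  (2 * (lam - 1) - c) * (x / k%:R) <= psi (lam * (x / k%:R)) - psi (x / k%:R).

(* If [psi] is constant between [x] and [lam * x], the difference of Selberg's formula
   at these two points is carried by its second sum, which forces almost all terms
   to attain the bound of [psi_diff_le]. *)
Lemma unsaturated_mass_le (lam c e Z0 : R) : 1 < lam <= 3 -> 0 < c -> 0 < e ->
  1 <= Z0 -> exists2 Z, Z0 <= Z &
  exists X : R, forall x, X <= x -> psi (lam * x) = psi x ->
  \sum_(1 <= k < (tr (x / Z)).+1 | ~~ saturated lam c x k) mangoldt k / k%:R <= e * ln x.
Proof.
move=> /andP[lam1 lam3] c_gt0 e_gt0 Z0_ge1.
(* The budget [e * c] is halved: one [e2] is the error in [psi_diff_le], the other absorbs the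
   bounded terms. *)
have [e2 e2_gt0 def_e2] : exists2 e2 : R, 0 < e2 & 2 * e2 = e * c.
  by exists (e * c / 2); [rewrite divr_gt0 // mulr_gt0 | field].
have [Y Y_ge1 HY] := psi_diff_le e2_gt0.
have [C C_gt0 selberg] : exists2 C : R, 0 < C &
    forall x, 1 <= x -> `|selberg_sum x - 2 * x * ln x| <= C * x.
  by exists 154; [rewrite ltr0n | exact: selberg_formula].
pose Z := Num.max Z0 Y; exists Z; first by rewrite le_max lexx.
have Z_ge1 : 1 <= Z by rewrite le_max Z0_ge1.
(* The bounded terms: [8 * (4 + e2)] from the Mertens error, [4 * C] from Selberg's formula at [x]
   and [lam * x], 24 from [psi x * ln lam], and the last term from the [k] beyond [x / Z]. *)
pose K := 8 * (4 + e2) + (4 * C + 24 + 24 * (24 * Z)).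
exists (Num.max Z (expR (K / e2))) => x.
rewrite ge_max => /andP[le_Zx le_Ex] gap.
have x_gt0 : 0 < x by lra.
have x_ge0 := ltW x_gt0.
have lx_ge0 : 0 <= lam * x by apply: mulr_ge0 => //; lra.
have x_ge1 : 1 <= x by lra.
have Z_gt0 : 0 < Z by lra.
have lam_x : x <= lam * x <= 3 * x.
  by rewrite ler_peMl ?(ltW lam1) //= ler_wpM2r.
have ln_x : K / e2 <= ln x.
  by rewrite -[X in X <= _]expRK ler_ln ?posrE ?expR_gt0.
have ln_x_ge0 : 0 <= ln x by apply: ln_ge0.
rewrite ler_pdivrMr // in ln_x.
set N := tr (x / Z).
have le_Nx : (N <= tr x)%N.
  by apply: le_truncn; rewrite ler_pdivrMr // ler_peMr.
have le_Nlx : (N <= tr (lam * x))%N.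
  by apply: (leq_trans le_Nx); apply: le_truncn; case/andP: lam_x.
have geZ k : (1 <= k < N.+1)%N -> Z <= x / k%:R.
  case/andP=> k_gt0; rewrite ltnS truncn_ge_nat; last by rewrite divr_ge0 // ltW.
  by rewrite ler_pdivlMr // ler_pdivlMr ?ltr0n // mulrC.
(* The difference of the second Selberg sums at [lam * x] and [x], restricted to the [k] with
   [x / k >= Z], where [psi_diff_le] applies. *)
pose D := \sum_(1 <= k < N.+1) mangoldt k * (psi (lam * (x / k%:R)) - psi (x / k%:R)).
have D_lb : 2 * (lam - 1) * (x * ln x) - (4 * C + 24 + 24 * (24 * Z)) * x <= D.
  have lx_ge1 : 1 <= lam * x by case/andP: lam_x => ? _; lra.
  have := selberg _ lx_ge1; have := selberg x x_ge1.
  rewrite !ler_norml /selberg_sum gap => /andP[_ ubx] /andP[lbl _].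
  have ln_lx : ln (lam * x) = ln lam + ln x by rewrite lnM ?posrE //; lra.
  have ln_lam0 : 0 <= ln lam by apply: ln_ge0; rewrite ltW.
  have ln_lam3 : ln lam <= 3 by apply: (le_trans (ln_le_id _)) => //; lra.
  have sx : \sum_(1 <= k < N.+1) mangoldt k * psi (x / k%:R) <=
            \sum_(1 <= k < (tr x).+1) mangoldt k * psi (x / k%:R).
    rewrite (@big_cat_nat _ _ _ N.+1 1 (tr x).+1) //= lerDl sumr_ge0 // => k _.
    by rewrite mulr_ge0 ?mangoldt_ge0 ?psi_ge0.
  have slx : \sum_(1 <= k < (tr (lam * x)).+1) mangoldt k * psi (lam * x / k%:R) <=
      \sum_(1 <= k < N.+1) mangoldt k * psi (lam * (x / k%:R)) + 24 * (24 * Z) * x.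
    rewrite (@big_cat_nat _ _ _ N.+1 1 (tr (lam * x)).+1) //=.
    under [X in X + _ <= _]eq_bigr do rewrite -mulrA.
    rewrite lerD2l.
    (* For [k > x / Z] the factor [psi (lam * x / k)] is at most [psi (lam * Z)], a bound
       independent of [x]. *)
    have : psi_nat R (tr (lam * x)) * psi (lam * Z) <= 24 * (24 * Z) * x.
      have h1 : psi (lam * x) <= 8 * (lam * x) by apply: psi_le.
      have h2 : psi (lam * Z) <= 8 * (lam * Z) by apply: psi_le; rewrite mulr_ge0 ?ltW //; lra.
      have h3 : lam * Z <= 3 * Z by rewrite ler_wpM2r // ltW.
      have h4 : psi (lam * x) <= 24 * x by case/andP: lam_x => _ ?; lra.
      have h5 : psi (lam * Z) <= 24 * Z by lra.
      have -> : 24 * (24 * Z) * x = (24 * x) * (24 * Z) by ring.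
      by apply: ler_pM => //; apply: psi_ge0.
    apply: le_trans; rewrite mulr_suml.
    rewrite [X in _ <= X](@big_cat_nat _ _ _ N.+1 1 (tr (lam * x)).+1) //=.
    rewrite -[X in X <= _]add0r; apply: lerD.
      by apply: sumr_ge0 => k _; rewrite mulr_ge0 ?mangoldt_ge0 ?psi_ge0.
    apply: ler_sum_nat => k; rewrite mem_trunc_itv ?divr_ge0 ?(ltW Z_gt0) // => /andP[lt_k _].
    rewrite ler_wpM2l ?mangoldt_ge0 // le_psi // -mulrA ler_wpM2l //; first lra.
    rewrite ler_pdivrMr; last by apply: le_lt_trans lt_k; rewrite divr_ge0 // ltW.
    by rewrite mulrC -ler_pdivrMr // ltW.
  have -> : D = \sum_(1 <= k < N.+1) mangoldt k * psi (lam * (x / k%:R)) -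
      \sum_(1 <= k < N.+1) mangoldt k * psi (x / k%:R).
    by rewrite -sumrB; apply: eq_bigr => k _; rewrite mulrBr.
  have psx : psi x <= 8 * x by apply: psi_le.
  have psx0 := psi_ge0 x.
  rewrite ln_lx in lbl.
  have q1 : psi x * ln lam <= 8 * x * 3 by apply: ler_pM.
  have q2 : 0 <= lam * x * ln lam by rewrite mulr_ge0.
  have /andP[_ q3] := lam_x.
  have q4 : C * (lam * x) <= C * (3 * x) by rewrite ler_pM2l.
  move: lbl ubx sx slx; do 4 move: (\sum_(_ <= _ < _) _) => ?; nra.
(* Each [k] contributes at most the extremal density, and each unsaturated [k] falls short of it by
   at least [c]. *)
have D_ub : D <= x * ((2 * (lam - 1) + e2) * mertens (x / Z) -
   c * \sum_(1 <= k < N.+1 | ~~ saturated lam c x k) mangoldt k / k%:R).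
  rewrite /mertens -/N [X in _ - _ * X]big_mkcond !mulr_sumr -sumrB mulr_sumr.
  apply: ler_sum_nat => k k_itv; have le_Zk := geZ k k_itv.
  have -> : forall d : R, x * (d * (mangoldt k / k%:R) - c *
      (if ~~ saturated lam c x k then mangoldt k / k%:R else 0)) =
      mangoldt k * ((d - c * (~~ saturated lam c x k)%:R) * (x / k%:R)).
    by move=> d; case: (saturated lam c x k) => /=; ring.
  apply: ler_wpM2l; first exact: mangoldt_ge0.
  have xk_ge1 : 1 <= x / k%:R by lra.
  case: (boolP (saturated lam c x k)) => [_|]; rewrite /= ?mulr0 ?subr0 ?mulr1.
    have le_Yk : Y <= x / k%:R by apply: le_trans le_Zk; rewrite le_max lexx orbT.
    have := HY _ (lam * (x / k%:R)) le_Yk.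
    have -> : x / k%:R <= lam * (x / k%:R) <= 3 * (x / k%:R).
      by rewrite ler_peMl ?(ltW lam1) ?ler_wpM2r //; lra.
    by move=> /(_ isT) h; apply: (le_trans h); rewrite le_eqVlt; apply/orP; left; apply/eqP; ring.
  rewrite /saturated -ltNge => /ltW h; apply: (le_trans h).
  by rewrite ler_wpM2r //; lra.
have le_m : mertens (x / Z) <= ln x + 8.
  have /andP[_ h] := mertens_bounds x_ge1; apply: le_trans h; apply: le_mertens.
  by rewrite ler_pdivrMr // ler_peMr.
set B := \sum_(_ <= _ < _ | _) _ in D_ub *.
have : x * (2 * (lam - 1) * ln x - (4 * C + 24 + 24 * (24 * Z))) <=
   x * ((2 * (lam - 1) + e2) * (ln x + 8) - c * B).
  apply: le_trans (le_trans D_lb (le_trans D_ub _)); first by lra.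
  rewrite ler_pM2l // lerD2r ler_wpM2l //; lra.
rewrite ler_pM2l // => h.
have hB : c * B <= 2 * e2 * ln x.
  have : 2 * (lam - 1) <= 4 by lra.
  move: h ln_x; rewrite /K; clear; nra.
by rewrite -(ler_pM2l c_gt0) mulrA [c * e]mulrC -def_e2.
Qed.

(** * From saturated indices to rich intervals *)

Section Reflection.
Variable rho : R.
Local Notation delta := (rho - 1).
Local Notation lam := (rho ^+ 4).

Lemma expr4_gt1 : 1 < rho -> 1 < lam.
Proof. by move=> rho_gt1; rewrite exprn_egt1. Qed.

Lemma expr4_le3 : 1 < rho -> rho <= 5 / 4 -> lam <= 3.
Proof.
move=> rho_gt1 rho_le.
have rho0 : 0 <= rho by lra.
have h1 : rho * rho <= 25 / 16.
  have : rho * rho <= 5 / 4 * (5 / 4) by apply: ler_pM.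
  lra.
have h0 : 0 <= rho * rho by apply: mulr_ge0.
have -> : lam = rho * rho * (rho * rho) by ring.
have : rho * rho * (rho * rho) <= 25 / 16 * (25 / 16) by apply: ler_pM.
lra.
Qed.

Local Notation saturated := (saturated lam (delta / 4)).

(** The density 3/2 lies strictly between the density 2 of saturated intervals and the average
    density 1 given by Mertens; the room on both sides absorbs the losses. *)
Definition rich a b := forall t, a <= t -> rho * t <= b ->
  3 / 2 * delta * t <= psi (rho * t) - psi t.

(** The parts of the saturated interval on either side of [(t, rho * t]] have density at most about
    2, so the middle part must have nearly density 2. The losses are [delta / 4] from saturation,
    [delta / 16] from the left part and at most [3 * delta / 16] from the right part, all times [y]:
    together [delta / 2]. *)
Lemma saturated_rich : 1 < rho -> rho <= 5 / 4 -> exists2 Y : R, 1 <= Y &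
  forall x k, Y <= x / k%:R -> saturated x k -> rich (x / k%:R) (lam * (x / k%:R)).
Proof.
move=> rho_gt1 rho_le; have lam1 := expr4_gt1 rho_gt1; have lam3 := expr4_le3 rho_gt1 rho_le.
have [|Y Y_ge1 HY] := @psi_diff_le (delta / 16); first by rewrite divr_gt0 // subr_gt0.
exists Y => // x k; rewrite /saturated; move: (x / k%:R) => y le_Yy sat_y t le_yt le_rt.
have t_ge1 : 1 <= t by lra.
have le_trt : t <= rho * t by rewrite ler_peMl //; lra.
have H1 : psi t - psi y <= 2 * (t - y) + delta / 16 * y.
  apply: HY => //; rewrite le_yt /=.
  have : lam * y <= 3 * y by rewrite ler_wpM2r //; lra.
  lra.
have H2 : psi (lam * y) - psi (rho * t) <= 2 * (lam * y - rho * t) + delta / 16 * (rho * t).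
  apply: HY; first lra.
  rewrite le_rt /=.
  have : lam * y <= 3 * y by rewrite ler_wpM2r //; lra.
  lra.
have lam_y : lam * y <= 3 * y by rewrite ler_wpM2r //; lra.
have d_gt0 : 0 < delta by lra.
have p1 : delta * (rho * t) <= delta * (3 * y) by rewrite ler_pM2l //; lra.
have p2 : delta * y <= delta * t by rewrite ler_pM2l.
nra.
Qed.

End Reflection.
End Gaps.

(** * Choice of a centre of reflection *)

Section Anchor.
Variable R : realType.
Implicit Types (x y a b t Z W : R) (k v : nat) (bad : pred nat).
Local Notation tr := (@Num.trunc R).
Local Notation mangoldt := (@mangoldt R).

Definition window_mass bad (N : nat) a b : R :=
  \sum_(1 <= k < N.+1 | bad k && (a <= k%:R <= b)) mangoldt k / k%:R.

(* Averaging over [v]: both families of windows are symmetric in [k] and [v]. *)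
Lemma exists_anchor bad (d e W Z x : R) :
  1 <= W -> 1 <= Z -> W * Z <= x / (W * Z) ->
  \sum_(1 <= k < (tr (x / Z)).+1 | bad k) mangoldt k / k%:R <= e * ln x ->
  2 * e * (2 * ln W + 17) < d * (1 - e) / 2 ->
  0 < d -> 0 < e < 1 ->
  4 * ln (W * Z) + 32 <= (1 - e) * ln x -> 0 < ln x ->
  exists v, [/\ ~~ bad v, W * Z <= v%:R <= x / (W * Z),
    window_mass bad (tr (x / Z)) (v%:R / W) (v%:R * W) <= d &
    window_mass bad (tr (x / Z)) (x / v%:R / W) (x / v%:R * W) <= d].
Proof.
move=> W_ge1 Z_ge1 WZ_x mass small d_gt0 /andP[e_gt0 e_lt1] large lnx_gt0.
have WZ_ge1 : 1 <= W * Z by rewrite mulr_ege1.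
have W_gt0 : 0 < W by lra.
have Z_gt0 : 0 < Z by lra.
have WZ_gt0 : 0 < W * Z by lra.
have x_gt0 : 0 < x.
  by rewrite ler_pdivlMr // in WZ_x; apply: lt_le_trans WZ_x; rewrite !mulr_gt0.
set N := tr (x / Z) in mass *.
pose w k := mangoldt k / k%:R.
have w_ge0 k : 0 <= w k by apply: weight_ge0.
pose near1 v k := (v%:R / W <= k%:R <= v%:R * W).
pose near2 v k := (x / v%:R / W <= k%:R <= x / v%:R * W).
(* The range of [v] keeps both windows, around [v] and around [x / v], between [Z] and [x / Z]. *)
pose G v := ~~ bad v && (W * Z <= v%:R <= x / (W * Z)).
(* Otherwise each [v] in [G] sees bad mass above [d]. Summed over [G], whose mass is at least
   [(1 - e) / 2 * ln x], this exceeds what the exchanged sum allows: each bad [k] meets only two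
   windows of [v], each of mass at most [2 ln W + 17]. *)
apply: contrapT => none.
have far v : G v -> d <= \sum_(1 <= k < N.+1 | bad k)
    w k * ((near1 v k)%:R + (near2 v k)%:R).
  move=> /andP[v_sat v_itv]; apply: ltW; rewrite ltNge; apply/negP => le_d.
  apply: none; exists v.
  have split_sum : \sum_(1 <= k < N.+1 | bad k) w k * ((near1 v k)%:R + (near2 v k)%:R) =
      window_mass bad N (v%:R / W) (v%:R * W) + window_mass bad N (x / v%:R / W) (x / v%:R * W).
    under eq_bigr do rewrite mulrDr.
    rewrite big_split /window_mass /= !big_mkcondr; congr (_ + _); apply: eq_bigr => k _.
      by rewrite /w -/(near1 v k); case: (near1 v k); rewrite ?mulr1 ?mulr0.
    by rewrite /w -/(near2 v k); case: (near2 v k); rewrite ?mulr1 ?mulr0.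
  have ge0 a b : 0 <= window_mass bad N a b.
    by apply: sumr_ge0 => k _; apply: weight_ge0.
  rewrite split_sum in le_d; split=> //; apply: le_trans le_d.
    by rewrite lerDl.
  by rewrite lerDr.
have le_NM : (tr (x / (W * Z)) <= N)%N.
  apply: le_truncn; apply: ler_wpM2l; first exact: ltW.
  by rewrite lef_pV2 ?posrE // ler_peMl // ltW.
have mass_G : ln x * (1 - e) / 2 <= \sum_(1 <= v < N.+1 | G v) w v.
  have : mertens (x / (W * Z)) - mertens (W * Z) <=
      \sum_(1 <= v < N.+1 | G v) w v + \sum_(1 <= v < N.+1 | bad v) w v.
    rewrite mertens_diff // (@big_nat_widenl _ _ _ _ 1) //=.
    rewrite (@big_nat_widen _ _ _ 1 _ N.+1) ?ltnS //=.
    rewrite big_mkcond [X in _ <= X + _]big_mkcond [X in _ <= _ + X]big_mkcond -big_split /=.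
    apply: ler_sum => v _; rewrite mem_trunc_itv ?(ltW WZ_gt0) ?divr_ge0 ?(ltW x_gt0) ?(ltW WZ_gt0) //.
    rewrite /G; case: ifP => [/andP[/ltW -> ->]|_].
      by case: (bad v); rewrite /= ?addr0 ?add0r.
    by apply: addr_ge0; case: ifP.
  have /andP[lb _] : ln (x / (W * Z)) - 8 <= mertens (x / (W * Z)) <= ln (x / (W * Z)) + 8.
    by apply: mertens_bounds; lra.
  have /andP[_ ub] := mertens_bounds WZ_ge1.
  rewrite ln_div ?posrE // in lb.
  by move: mass; rewrite -/w => *; lra.
have upper : \sum_(1 <= v < N.+1 | G v) w v * \sum_(1 <= k < N.+1 | bad k)
    w k * ((near1 v k)%:R + (near2 v k)%:R) <= e * ln x * (2 * (2 * ln W + 17)).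
  under eq_bigr do rewrite mulr_sumr.
  rewrite exchange_big_nat /=.
  apply: (@le_trans _ _ (\sum_(1 <= k < N.+1 | bad k) w k * (2 * (2 * ln W + 17)))).
    rewrite big_nat_cond [X in _ <= X]big_nat_cond.
    apply: ler_sum => k /andP[/andP[k_gt0 _] bad_k].
    have kR_gt0 : 0 < k%:R :> R by rewrite ltr0n.
    under eq_bigr do rewrite mulrCA.
    rewrite -mulr_sumr ler_wpM2l //.
    have window c (P : pred nat) : 0 < c -> (forall v, (0 < v)%N -> P v -> c / W <= v%:R <= c * W) ->
        \sum_(1 <= v < N.+1 | G v && P v) w v <= 2 * ln W + 17.
      move=> c_gt0 HP; rewrite big_nat_cond.
      have le_cW : c / W <= c * W.
        rewrite ler_pdivrMr // -mulrA ler_peMr ?(ltW c_gt0) //.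
        by rewrite mulr_ege1.
      apply: le_trans (sum_window_le_ln (a := c / W) (b := c * W) _ _ _) _.
      - by rewrite divr_gt0.
      - by move=> v /andP[/andP[v_gt0 _] /andP[_]]; apply: HP.
      have -> : c * W / (c / W) = W * W by field; lra.
      by rewrite lnM ?posrE //; lra.
    have -> : 2 * (2 * ln W + 17) = (2 * ln W + 17) + (2 * ln W + 17) by ring.
    under eq_bigr do rewrite mulrDr.
    rewrite big_split /=; apply: lerD.
      rewrite (eq_bigr (fun v => if near1 v k then w v else 0)) => [|v _]; last first.
        by case: (near1 v k); rewrite ?mulr1 ?mulr0.
      rewrite -big_mkcondr; apply: (window k%:R) => // v v_gt0 /andP[].
      rewrite ler_pdivrMr // => h1 h2; rewrite h1 andbT.
      by rewrite ler_pdivrMr.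
    rewrite (eq_bigr (fun v => if near2 v k then w v else 0)) => [|v _]; last first.
      by case: (near2 v k); rewrite ?mulr1 ?mulr0.
    rewrite -big_mkcondr; apply: (window (x / k%:R)) => [|v v_gt0]; first by rewrite divr_gt0.
    have vR_gt0 : 0 < v%:R :> R by rewrite ltr0n.
    rewrite /near2 ![_ / _ * W]mulrAC !ler_pdivrMr // !ler_pdivlMr // => /andP[h1 h2].
    by apply/andP; split; clear -h1 h2; lra.
  rewrite -mulr_suml ler_wpM2r // mulr_ge0 // addr_ge0 // mulr_ge0 //.
  exact: ln_ge0.
have lower : d * (ln x * (1 - e) / 2) <= \sum_(1 <= v < N.+1 | G v) w v *
    \sum_(1 <= k < N.+1 | bad k) w k * ((near1 v k)%:R + (near2 v k)%:R).
  apply: (@le_trans _ _ (d * \sum_(1 <= v < N.+1 | G v) w v)).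
    by rewrite ler_pM2l.
  rewrite mulr_sumr; apply: ler_sum => v Gv.
  by rewrite mulrC ler_wpM2l // far.
have := le_trans lower upper; apply/negP; rewrite -ltNge.
have -> : e * ln x * (2 * (2 * ln W + 17)) = (2 * e * (2 * ln W + 17)) * ln x by ring.
have -> : d * (ln x * (1 - e) / 2) = (d * (1 - e) / 2) * ln x by ring.
by rewrite ltr_pM2r.
Qed.

End Anchor.

(** * Prime powers in short intervals *)

Section PrimePowerGaps.
Variable R : realType.
Implicit Types (x y a b t Z W : R) (k v : nat).
Local Notation tr := (@Num.trunc R).
Local Notation mangoldt := (@mangoldt R).

(** * Growth of rich intervals by reflection *)

Section Reflection.
Variable rho : R.
Local Notation delta := (rho - 1).
Local Notation lam := (rho ^+ 4).
Local Notation saturated := (saturated lam (delta / 4)).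
Local Notation rich := (rich rho).

(** Weighting by [1 / k] costs at most a factor [rho <= 5 / 4], which turns the density 3/2 into
    6/5, still above 1. *)
Lemma rich_mertens_step a b t : 1 < rho -> rho <= 5 / 4 -> 0 < t ->
  rich a b -> a <= t -> rho * t <= b -> 6 / 5 * delta <= mertens (rho * t) - mertens t.
Proof.
move=> rho_gt1 rho_le t_gt0 ab_rich le_at le_tb.
have le_trt : t <= rho * t by rewrite ler_peMl //; lra.
have h1 := ab_rich t le_at le_tb.
have h2 : psi (rho * t) - psi t <= rho * t * (mertens (rho * t) - mertens t).
  by apply: psi_mertens_diff; rewrite le_trt andbT ltW.
have {h1 h2} := le_trans h1 h2.
rewrite [rho * t * _]mulrAC ler_pM2r //; set m := mertens _ - _ => h.
have m_ge0 : 0 <= m by rewrite subr_ge0 le_mertens.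
clearbody m.
have h2 : rho * m <= 5 / 4 * m by rewrite ler_wpM2r.
lra.
Qed.

Lemma rich_mertens a (q : nat) : 1 < rho -> rho <= 5 / 4 -> 0 < a ->
  rich a (a * rho ^+ q) -> 6 / 5 * delta * q%:R <= mertens (a * rho ^+ q) - mertens a.
Proof.
move=> rho_gt1 rho_le a_gt0 a_rich; have rho_gt0 : 0 < rho by lra.
have step i : (i <= q)%N -> 6 / 5 * delta * i%:R <= mertens (a * rho ^+ i) - mertens a.
  elim: i => [|i IHi] lt_iq; first by rewrite mulr0 mulr1 subrr.
  have := IHi (ltnW lt_iq).
  have := @rich_mertens_step _ _ (a * rho ^+ i) rho_gt1 rho_le _ a_rich.
  rewrite mulrCA -exprS mulr_gt0 ?exprn_gt0 // => /(_ isT).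
  rewrite ler_peMr ?exprn_ege1 ?(ltW rho_gt1) ?(ltW a_gt0) // => /(_ isT).
  rewrite ler_pM2l // ler_weXn2l ?(ltW rho_gt1) // => /(_ isT).
  by rewrite -[i.+1%:R]natr1; move: (i%:R : R) => *; lra.
exact: step.
Qed.

(* For [t] in the reflected interval, the rich interval around [x / t] has more mass
   than its unsaturated part, so it contains a saturated [k] with [x / k] just below [t]. *)
Lemma rich_reflect Y x Z a b : 1 < rho -> rho <= 5 / 4 -> 1 <= Z -> Y <= Z ->
  (forall k, Y <= x / k%:R -> saturated x k -> rich (x / k%:R) (lam * (x / k%:R))) ->
  0 < a -> 0 < x -> b <= x / Z -> rho * a <= b -> rich a b ->
  window_mass (fun k => ~~ saturated x k) (tr (x / Z)) a b <= delta ->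
  rich (x * rho / b) (rho ^+ 3 * x / a).
Proof.
move=> rho_gt1 rho_le Z_ge1 le_YZ HY a_gt0 x_gt0 le_bxZ le_ab ab_rich mass t le_t t_le.
have rho_gt0 : 0 < rho by lra.
have b_gt0 : 0 < b by apply: lt_le_trans le_ab; rewrite mulr_gt0.
have t_gt0 : 0 < t by apply: lt_le_trans le_t; rewrite divr_gt0 ?mulr_gt0.
(* The enlarged upper end allows [x / t] to fall below [a]; [s] moves it back into the rich
   interval. The exponent 3 keeps [s * t <= rho ^+ 2 * x], so a [k] up to [rho * s] still satisfies
   [rho * t <= lam * x / k]. *)
pose s := Num.max (x / t) a.
have s_gt0 : 0 < s by rewrite lt_max a_gt0 orbT.
have le_as : a <= s by rewrite le_max lexx orbT.
have le_xs : x / t <= s by rewrite le_max lexx.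
have le_rsb : rho * s <= b.
  rewrite /s maxr_pMr ?(ltW rho_gt0) // ge_max le_ab andbT mulrA ler_pdivrMr //.
  by rewrite ler_pdivrMr // in le_t; rewrite mulrC [b * t]mulrC.
have s_le : s * t <= rho ^+ 2 * x.
  have -> : s * t = Num.max x (a * t).
    by rewrite /s maxr_pMl ?(ltW t_gt0) // divfK // gt_eqF.
  rewrite ge_max ler_peMl ?exprn_ege1 ?(ltW rho_gt1) ?(ltW x_gt0) //=.
  rewrite ler_pdivlMr // in t_le.
  rewrite -(ler_pM2l rho_gt0); apply: le_trans (le_trans t_le _).
    by rewrite mulrCA mulrC.
  by rewrite mulrA -exprS.
have le_srs : s <= rho * s by rewrite ler_peMl ?(ltW s_gt0) ?(ltW rho_gt1).
(* Richness gives this step a mass of at least [6 / 5 * delta], more than the total unsaturated mass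
   [delta] of the window. *)
have [k [/andP[lt_sk le_krs] k_sat]] : exists k, s < k%:R <= rho * s /\ saturated x k.
  apply: contrapT => none.
  have : mertens (rho * s) - mertens s <= delta.
    apply: le_trans mass; rewrite mertens_diff // /window_mass.
    rewrite (@big_nat_widenl _ _ _ _ 1) //=.
    have le_N : (tr (rho * s) <= tr (x / Z))%N.
      by apply: le_truncn; apply: le_trans le_bxZ.
    rewrite (@big_nat_widen _ _ _ 1 _ (tr (x / Z)).+1) ?ltnS //=.
    rewrite big_mkcond [X in _ <= X]big_mkcond; apply: ler_sum => k _ /=.
    rewrite mem_trunc_itv ?(ltW s_gt0) ?mulr_ge0 ?(ltW rho_gt0) ?(ltW s_gt0) //.
    have := weight_ge0 R k; case: ifP => [/andP[lt_sk le_krs] w_ge0|_]; last by case: ifP.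
    rewrite ifT // (le_trans le_krs) // (le_trans le_as (ltW lt_sk)) !andbT.
    by apply/negP => k_sat; apply: none; exists k; rewrite lt_sk le_krs.
  have := rich_mertens_step rho_gt1 rho_le s_gt0 ab_rich le_as le_rsb.
  by lra.
have k_gt0 : 0 < k%:R :> R by apply: lt_trans lt_sk.
have le_kxZ : k%:R <= x / Z by apply: le_trans le_bxZ; apply: le_trans le_rsb.
have le_Zk : Z <= x / k%:R.
  by rewrite ler_pdivlMr // mulrC -ler_pdivlMr //; lra.
apply: (HY k) => //; first exact: le_trans le_Zk.
  rewrite ler_pdivrMr // mulrC -ler_pdivrMr //.
  by apply: le_trans (ltW lt_sk).
rewrite mulrA ler_pdivlMr //.
apply: (@le_trans _ _ (rho * t * (rho * s))); first by rewrite ler_pM2l // mulr_gt0.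
have -> : rho * t * (rho * s) = rho ^+ 2 * (s * t) by ring.
have -> : lam * x = rho ^+ 2 * (rho ^+ 2 * x) by ring.
by rewrite ler_pM2l // exprn_gt0.
Qed.

Lemma le_window_mass bad N a b a' b' : a' <= a -> b <= b' ->
  window_mass bad N a b <= window_mass bad N a' b'.
Proof.
move=> le_a le_b; rewrite /window_mass big_mkcond [X in _ <= X]big_mkcond.
apply: ler_sum => k _; have := weight_ge0 R k; case: ifP => [/and3P[-> le_ak le_kb] _|_].
  by rewrite (le_trans le_a le_ak) (le_trans le_kb le_b).
by case: ifP.
Qed.

(** If [psi] were constant on [[x, lam * x]], repeated reflection about an anchor would give a rich
    interval too long for Mertens' estimate. *)
Lemma psi_lt_expr4 : 1 < rho -> rho <= 5 / 4 ->
  exists X, forall x, X <= x -> psi x < psi (lam * x).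
Proof.
move=> rho_gt1 rho_le; have rho_gt0 : 0 < rho by lra.
have d_gt0 : 0 < delta by lra.
have lam1 := expr4_gt1 rho_gt1; have lam3 := expr4_le3 rho_gt1 rho_le.
have [Y Y_ge1 HY] := saturated_rich rho_gt1 rho_le.
(* The final interval has [4 n + 4] steps. Its Mertens mass would be at least
   [6 / 5 * delta * (4 n + 4)] and at most [delta * (4 n + 4) + 16], which is impossible once
   [delta * n > 20]. *)
pose n := (tr (20 / delta)).+1.
have n_large : 20 < delta * n%:R.
  by rewrite mulrC -ltr_pdivrMr // truncnS_gt.
clearbody n.
(* Wide enough for the windows of ratio [W] around [v] and [x / v] to contain every interval that
   occurs in [n] double reflections. *)
pose W := rho ^+ (2 * n + 4).
have W_ge1 : 1 <= W by rewrite exprn_ege1 ?ltW.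
have W_gt0 : 0 < W by lra.
have lnW_ge0 : 0 <= ln W by apply: ln_ge0.
(* This makes [2 * e * (2 * ln W + 17)] at most [delta / 8], below the bound [delta * (1 - e) / 2]
   required by [exists_anchor]. *)
pose e := Num.min (1 / 2) (delta / (16 * (2 * ln W + 17))).
have L_gt0 : 0 < 16 * (2 * ln W + 17) by lra.
have e_gt0 : 0 < e by rewrite lt_min divr_gt0 // divr_gt0.
have e_le1 : e <= 1 / 2 by rewrite ge_min lexx.
have e_small : e * (16 * (2 * ln W + 17)) <= delta.
  by rewrite -ler_pdivlMr // ge_min lexx orbT.
clearbody e.
have c_gt0 : 0 < delta / 4 by rewrite divr_gt0.
have lam_itv : 1 < lam <= 3 by rewrite lam1.
have [Z le_YZ [X HX]] := unsaturated_mass_le lam_itv c_gt0 e_gt0 Y_ge1.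
have Z_ge1 : 1 <= Z by lra.
have WZ_ge1 : 1 <= W * Z by rewrite mulr_ege1.
have WZ_gt0 : 0 < W * Z by lra.
exists (Num.max (Num.max X (W * Z * (W * Z))) (expR (8 * ln (W * Z) + 64))) => x.
rewrite !ge_max -andbA => /and3P[le_Xx le_WZx le_Ex].
rewrite lt_neqAle le_psi ?andbT; last first.
  have : 0 < x by apply: lt_le_trans le_Ex; apply: expR_gt0.
  by move=> x_gt0; rewrite ler_peMl ?ltW.
apply/negP => /eqP gap.
have x_gt0 : 0 < x by apply: lt_le_trans le_Ex; apply: expR_gt0.
have ln_x : 8 * ln (W * Z) + 64 <= ln x.
  by rewrite -[X in X <= _]expRK ler_ln ?posrE ?expR_gt0.
have lnWZ_ge0 : 0 <= ln (W * Z) by apply: ln_ge0.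
have mass := HX x le_Xx (esym gap).
have [] := exists_anchor W_ge1 Z_ge1 _ mass _ d_gt0 _ _ _.
- by rewrite ler_pdivlMr.
- move: e_small e_le1 e_gt0 lnW_ge0 d_gt0; clear; nra.
- by rewrite e_gt0 /=; lra.
- have lnx_ge0 : 0 <= ln x by lra.
  have e_ge : 1 / 2 <= 1 - e by lra.
  have h : 1 / 2 * ln x <= (1 - e) * ln x by apply: ler_wpM2r.
  lra.
- lra.
move=> v [/negPn v_sat /andP[v_ge v_le] win1 win2].
have v_gt0 : 0 < v%:R :> R by lra.
set w := x / v%:R in win2.
have w_gt0 : 0 < w by rewrite divr_gt0.
have vw : v%:R * w = x by rewrite /w mulrC divfK // gt_eqF.
have w_ge : W * Z <= w.
  by rewrite ler_pdivlMr // mulrC -ler_pdivlMr.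
have W_pow i : (i <= 2 * n + 4)%N -> rho ^+ i <= W.
  by move=> le_i; rewrite /W ler_weXn2l // ltW.
clearbody W.
have pow_gt0 i : 0 < rho ^+ i by rewrite exprn_gt0.
have Z_gt0 : 0 < Z by lra.
have top_w : w * W <= x / Z by rewrite ler_pdivlMr // -mulrA -vw [v%:R * w]mulrC ler_pM2l.
have top_v : v%:R * W <= x / Z by rewrite ler_pdivlMr // -mulrA -vw ler_pM2l.
have window (u : R) i j : 0 < u ->
   window_mass (fun k => ~~ saturated x k) (tr (x / Z)) (u / W) (u * W) <= delta ->
   (i <= 2 * n + 4)%N -> (j <= 2 * n + 4)%N ->
   window_mass (fun k => ~~ saturated x k) (tr (x / Z)) (u / rho ^+ i) (u * rho ^+ j) <= delta.
  move=> u_gt0 win i_le j_le; apply: le_trans win; apply: le_window_mass.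
    by rewrite ler_pM2l // lef_pV2 ?posrE // W_pow.
  by rewrite ler_pM2l // W_pow.
(* The start [j = 0] is the interval attached to the saturated [v], as [x / v = w]. One reflection
   leads to an interval around [v], a second one back to [w], with both ends moved outwards by
   [rho ^+ 2]. *)
have grow j : (j <= n)%N -> rich (w / rho ^+ (2 * j)) (w * rho ^+ (2 * j + 4)).
  elim: j => [|j IHj] lt_jn.
    rewrite muln0 expr0 divr1 mulrC; apply: HY => //.
    by apply: (le_trans le_YZ); apply: le_trans w_ge; rewrite ler_peMl //; lra.
  have rich1 : rich (v%:R / rho ^+ (2 * j + 3)) (v%:R * rho ^+ (2 * j + 3)).
    have := @rich_reflect Y x Z (w / rho ^+ (2 * j)) (w * rho ^+ (2 * j + 4))
      rho_gt1 rho_le Z_ge1 le_YZ (HY x) _ x_gt0 _ _ (IHj (ltnW lt_jn)) _.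
    have -> : x * rho / (w * rho ^+ (2 * j + 4)) = v%:R / rho ^+ (2 * j + 3).
      by rewrite -vw [(2 * j + 4)%N]addnS exprS; field; rewrite !gt_eqF.
    have -> : rho ^+ 3 * x / (w / rho ^+ (2 * j)) = v%:R * rho ^+ (2 * j + 3).
      by rewrite -vw exprD; field; rewrite !gt_eqF.
    apply.
    - by rewrite divr_gt0.
    - apply: le_trans top_w; apply: ler_wpM2l; [exact: ltW | apply: W_pow; clear -lt_jn; lia].
    - rewrite mulrCA ler_pM2l // ler_pdivrMr // -exprD -[rho in X in X <= _]expr1.
      by apply: ler_weXn2l; [exact: ltW | clear; lia].
    - by apply: window => //; clear -lt_jn; lia.
  have := @rich_reflect Y x Z _ _ rho_gt1 rho_le Z_ge1 le_YZ (HY x) _ x_gt0 _ _ rich1 _.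
  have -> : x * rho / (v%:R * rho ^+ (2 * j + 3)) = w / rho ^+ (2 * j.+1).
    rewrite -vw (_ : 2 * j.+1 = 2 * j + 2)%N ?[(2 * j + 3)%N]addnS ?exprS; last by clear; lia.
    by field; rewrite !gt_eqF.
  have -> : rho ^+ 3 * x / (v%:R / rho ^+ (2 * j + 3)) = w * rho ^+ (2 * j.+1 + 4).
    rewrite -vw (_ : 2 * j.+1 + 4 = 3 + (2 * j + 3))%N ?exprD; last by clear; lia.
    by field; rewrite !gt_eqF.
  apply.
  - by rewrite divr_gt0.
  - apply: le_trans top_v; apply: ler_wpM2l; [exact: ltW | apply: W_pow; clear -lt_jn; lia].
  - rewrite mulrCA ler_pM2l // ler_pdivrMr // -exprD -[rho in X in X <= _]expr1.
    by apply: ler_weXn2l; [exact: ltW | clear; lia].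
  - by apply: window => //; clear -lt_jn; lia.
have := grow n (leqnn n); set a := w / _.
have a_ge1 : 1 <= a.
  rewrite /a ler_pdivlMr // mul1r; apply: le_trans w_ge.
  by apply: (@le_trans _ _ W); [apply: W_pow; clear; lia | rewrite ler_peMr // ltW].
have a_gt0 : 0 < a by lra.
have -> : w * rho ^+ (2 * n + 4) = a * rho ^+ (4 * n + 4).
  rewrite (_ : 4 * n + 4 = 2 * n + (2 * n + 4))%N; last by clear; lia.
  by rewrite [rho ^+ (2 * n + (2 * n + 4))]exprD mulrA divfK ?gt_eqF.
move=> /(rich_mertens rho_gt1 rho_le a_gt0).
set q := (4 * n + 4)%N => h0.
have q_gt : 4 * n%:R <= q%:R :> R by rewrite -natrM ler_nat /q; clear; lia.
have b_ge1 : 1 <= a * rho ^+ q by rewrite mulr_ege1 // exprn_ege1 // ltW.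
have /andP[_ ub] := mertens_bounds b_ge1; have /andP[lb _] := mertens_bounds a_ge1.
have ln_rho : ln rho <= delta.
  rewrite -[X in ln X](subrK 1) addrC; apply: le_ln1Dx.
  by rewrite ltrBrDl subrr.
have h1 : ln (a * rho ^+ q) <= ln a + delta * q%:R.
  by rewrite lnM ?posrE // lnXn // lerD2l -[_ *+ q]mulr_natr ler_wpM2r.
have h2 : delta * (4 * n%:R) <= delta * q%:R by rewrite ler_pM2l.
move: h0 h1 h2 lb ub n_large; move: (mertens _) (mertens _) (ln a) (ln _) (q%:R).
by clear => *; lra.
Qed.

End Reflection.

Theorem prime_power_between (e : R) : 0 < e -> exists X, forall x, X <= x ->
  exists p k : nat, [/\ prime p, (0 < k)%N & x < (p ^ k)%:R <= (1 + e) * x].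
Proof.
(* For [0 < d <= 1], [(1 + d) ^+ 4 <= 1 + 15 d], whence the divisor 15. *)
move=> e_gt0; pose rho := 1 + Num.min (1 / 4) (e / 15).
set d := Num.min _ _ in rho.
have d_gt0 : 0 < d by rewrite lt_min !divr_gt0.
have d_le : d <= 1 / 4 by rewrite ge_min lexx.
have d_le_e : d <= e / 15 by rewrite ge_min lexx orbT.
have [||X HX] := @psi_lt_expr4 rho; [by rewrite /rho; lra | by rewrite /rho; lra |].
exists (Num.max X 1) => x; rewrite ge_max => /andP[le_Xx x_ge1].
have x_gt0 : 0 < x by lra.
have rho_le : rho ^+ 4 <= 1 + e.
  have -> : rho ^+ 4 = 1 + d * (4 + d * (6 + d * (4 + d))) by rewrite /rho; ring.
  have : d * (4 + d * (6 + d * (4 + d))) <= d * 15.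
    rewrite ler_pM2l //; move: d_gt0 d_le; clear; nra.
  lra.
have lt_psi : psi x < psi ((1 + e) * x).
  by apply: lt_le_trans (HX x le_Xx) _; apply: le_psi; rewrite ler_wpM2r ?(ltW x_gt0).
have le_x : x <= (1 + e) * x by rewrite ler_peMl ?(ltW x_gt0) //; lra.
have : psi ((1 + e) * x) - psi x != 0 by rewrite subr_eq0 gt_eqF.
rewrite /psi /psi_nat sum_trunc_diff //.
have [[k [/andP[lt_xk le_kx] /mangoldt_neq0[p [i [p_pr i_gt0 def_k]]]] _]|none] :=
  pselect (exists k : nat, x < k%:R <= (1 + e) * x /\ mangoldt k != 0).
  by exists p, i; split=> //; rewrite -def_k lt_xk.
rewrite big_nat big1 ?eqxx // => k; rewrite mem_trunc_itv; last 2 first.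
- exact: ltW.
- by apply: mulr_ge0; lra.
by move=> k_itv; apply: contrapT => /eqP k_neq0; apply: none; exists k.
Qed.

End PrimePowerGaps.

(** * Bounds for Zarankiewicz numbers *)

(** The vertices of [A] used are polynomials, coded by their [r] coefficients; the points of the
    plane over [F] are embedded in [B]. Only [m] polynomials fit when [m] is smaller than their
    number, hence the [minn]. *)
Lemma zarankiewicz_ge (F : finFieldType) (m n r : nat) :
  (0 < r)%N -> (#|F| ^ 2 <= n)%N ->
  (minn m (#|F| ^ r) * #|F| <= zarankiewicz m n 2 r)%N.
Proof.
move=> r_gt0 le_Fn.
have card_V : #|{: 'rV[F]_r}| = (#|F| ^ r)%N by rewrite card_mx mul1n.
pose M := minn m #|{: 'rV[F]_r}|.
pose P (i : 'I_M) : {poly F} := rVpoly (enum_val (widen_ord (geq_minr m _) i)).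
have P_inj : injective P.
  move=> i j /(can_inj rVpolyK)/enum_val_inj/(congr1 val) /= eq_ij.
  exact: val_inj.
have size_P i : (size (P i) <= r)%N by apply: size_poly.
have le_FFn : (#|{: F * F}| <= n)%N by rewrite card_prod mulnn.
pose point (u : F * F) : 'I_n := widen_ord le_FFn (enum_rank u).
have point_inj : injective point.
  by move=> u v /(congr1 val) /= eq_uv; apply/enum_rank_inj/val_inj.
pose edge (u : 'I_M * F) := (widen_ord (geq_minl m _) u.1, point (u.2, (P u.1).[u.2])).
have edge_inj : injective edge.
  move=> [i x] [j y] eq_e.
  have /point_inj[eq_xy _] : point (x, (P i).[x]) = point (y, (P j).[y]) := congr1 snd eq_e.
  by congr (_, _) => //; apply: val_inj; apply: (congr1 (fun e => val e.1) eq_e).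
have -> : (minn m (#|F| ^ r) * #|F| = #|[set edge u | u in {: 'I_M * F}]|)%N.
  by rewrite card_imset // card_prod card_ord /M card_V.
apply: (@leq_bigmax_cond _ _ (fun E : {set 'I_m * 'I_n} => #|E|)).
rewrite /biclique_free; apply/negP => /existsP[S /existsP[T]].
move=> /and3P[/cards2P[a [b [ne_ab defS]]] /eqP card_T /fintype.subsetP sub].
have mem_edge c j : c \in S -> j \in T ->
    exists i x, c = widen_ord (geq_minl m #|{: 'rV[F]_r}|) i /\ j = point (x, (P i).[x]).
  move=> cS jT; have /sub/imsetP[[i x] _ eq_e] : (c, j) \in finset.setX S T by rewrite inE cS.
  by exists i, x; split; [apply: (congr1 fst eq_e) | apply: (congr1 snd eq_e)].
have [aS bS] : a \in S /\ b \in S by rewrite defS !inE !eqxx orbT.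
have /card_gt0P[j0 j0T] : (0 < #|T|)%N by rewrite card_T.
have [i [_ [def_a _]]] := mem_edge a j0 aS j0T.
have [k [_ [def_b _]]] := mem_edge b j0 bS j0T.
have D_neq0 : P i - P k != 0.
  rewrite subr_eq0; apply: contraNneq ne_ab => /P_inj eq_ik.
  by rewrite def_a def_b eq_ik.
(* Common neighbours of [a] and [b] are points where the two polynomials agree, that is, roots of a
   nonzero polynomial of degree below [r]. *)
pose X := [set x | root (P i - P k) x].
have sub_TX : T \subset [set point (x, (P i).[x]) | x in X].
  apply/fintype.subsetP => j jT.
  have [i' [x [def_a' def_j]]] := mem_edge a j aS jT.
  have [k' [y [def_b' def_j']]] := mem_edge b j bS jT.
  have eq_i : i' = i.
    by apply: val_inj; have := congr1 val def_a; rewrite def_a'.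
  have eq_k : k' = k.
    by apply: val_inj; have := congr1 val def_b; rewrite def_b'.
  move: def_j'; rewrite def_j eq_i eq_k => /point_inj[<- eq_P].
  apply: imset_f; rewrite inE rootE !hornerE eq_P.
  by rewrite subrr.
have card_X : (#|X| < r)%N.
  rewrite cardE; apply: leq_trans (max_poly_roots D_neq0 _ (enum_uniq _)) _.
    by apply/allP => x; rewrite mem_enum inE.
  by apply: leq_trans (size_polyD _ _) _; rewrite size_polyN geq_max !size_P.
have := leq_trans (subset_leq_card sub_TX) (leq_imset_card _ _).
by rewrite card_T leqNgt card_X.
Qed.

(** * Upper bound by double counting *)

Section Upper.
Variables m n : nat.
Implicit Type E : {set 'I_m * 'I_n}.

Definition nbrs E (i : 'I_m) : {set 'I_n} := [set j | (i, j) \in E].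

Lemma card_edges E : #|E| = \sum_i #|nbrs E i|.
Proof.
rewrite -sum1_card (eq_bigr (fun i => \sum_(j | (i, j) \in E) 1)%N) => [|i _].
  by rewrite pair_big_dep /=; apply: eq_bigl => -[i j].
by rewrite -sum1_card; apply: eq_bigl => j; rewrite inE.
Qed.

(** Pairs of a vertex and an [r]-subset of its neighbourhood are counted by the subset: two vertices
    sharing one would form the forbidden subgraph. *)
Lemma sum_bin_nbrs E r : biclique_free 2 r E ->
  (\sum_i 'C(#|nbrs E i|, r) <= 'C(n, r))%N.
Proof.
move=> E_free.
under eq_bigr do rewrite -cards_draws -sum1_card.
rewrite (exchange_big_dep (fun T : {set 'I_n} => #|T| == r)) /=; last first.
  by move=> i T _; rewrite inE => /andP[].
rewrite -[X in 'C(X, _)]card_ord -card_draws -sum1_card.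
rewrite [X in (_ <= X)%N](eq_bigl (fun T : {set 'I_n} => #|T| == r)); last first.
  by move=> T; rewrite inE.
apply: leq_sum => T card_T; rewrite sum1_card.
rewrite leqNgt; apply/negP => /card_gt1P[a [b [aT bT ne_ab]]].
case/negP: E_free; apply/existsP; exists [set a; b].
apply/existsP; exists T; rewrite cards2 ne_ab card_T /=.
apply/fintype.subsetP => -[c j]; rewrite inE /= !inE => /andP[c_ab jT].
have : T \in [set A : {set 'I_n} | A \subset nbrs E c & #|A| == r].
  by case/orP: c_ab => /eqP ->.
by rewrite inE => /andP[/fintype.subsetP/(_ j jT)]; rewrite inE.
Qed.

End Upper.

Lemma expn_le_ffact d r : ((d - r) ^ r <= d ^_ r)%N.
Proof.
elim: r d => [|r IHr] d; first by rewrite expn0 ffactn0.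
rewrite ffactnS expnS (_ : d - r.+1 = d.-1 - r)%N; last by lia.
by apply: leq_mul; [lia | apply: IHr].
Qed.

Lemma ffact_le_expn n r : (n ^_ r <= n ^ r)%N.
Proof.
elim: r n => [|r IHr] n; first by rewrite expn0 ffactn0.
rewrite ffactnS expnS leq_mul2l (leq_trans (IHr _)) ?orbT //.
by case: r {IHr} => // r; rewrite leq_exp2r // leq_pred.
Qed.

(** By induction: multiplying the previous inequality by [t] leaves the surplus
    [r.+1%:R * s ^+ r * (t - s) ^+ 2]. *)
Lemma tangent_exp (R : realDomainType) (s t : R) (r : nat) : 0 <= s -> 0 <= t ->
  s ^+ r.+1 + r.+1%:R * s ^+ r * (t - s) <= t ^+ r.+1.
Proof.
move=> s_ge0 t_ge0; elim: r => [|r IHr].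
  by rewrite expr0 !expr1 mulr1 mul1r; lra.
rewrite [t ^+ r.+2]exprS; apply: le_trans (ler_wpM2l t_ge0 IHr).
rewrite -subr_ge0 -[r.+2%:R]natr1 !exprS.
have -> : t * (s * s ^+ r + r.+1%:R * s ^+ r * (t - s)) -
   (s * (s * s ^+ r) + (r.+1%:R + 1) * (s * s ^+ r) * (t - s)) =
   r.+1%:R * s ^+ r * (t - s) ^+ 2 by ring.
by rewrite mulr_ge0 ?sqr_ge0 // mulr_ge0 // exprn_ge0.
Qed.

(** Here [s] is the square root of [n]. For [m] close to [s ^+ r] the right side is small compared
    with [s * m], so [s * m] is the main term of the bound. *)
Lemma zarankiewicz_le (R : realDomainType) (m n r : nat) (s : R) :
  (0 < r)%N -> 0 < s -> s ^+ 2 = n%:R ->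
  r%:R * ((zarankiewicz m n 2 r)%:R - m%:R * r%:R - m%:R * s) <= s * (s ^+ r - m%:R).
Proof.
case: r => // r _ s_gt0 s2.
have [E E_free ->] : exists2 E : {set 'I_m * 'I_n}, biclique_free 2 r.+1 E &
    zarankiewicz m n 2 r.+1 = #|E|.
  have [|E E_free def_z] := @eq_bigmax_cond _ (fun E : {set 'I_m * 'I_n} =>
    biclique_free 2 r.+1 E) (fun E => #|E|); last by exists E.
  apply/card_gt0P; exists finset.set0; rewrite unfold_in /biclique_free.
  apply/negP => /existsP[S /existsP[T /and3P[card_S card_T /fintype.subsetP sub]]].
  have /card_gt0P[a aS] : (0 < #|S|)%N by rewrite (eqP card_S).
  have /card_gt0P[b bT] : (0 < #|T|)%N by rewrite (eqP card_T).
  by have := sub (a, b); rewrite !inE aS bT => /(_ isT).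
(* The truncated subtraction bounds the falling factorial from below by a pure power, to which the
   tangent line applies; it loses at most [m * r.+1] edges in all. *)
pose u i := (#|nbrs E i| - r.+1)%N.
have sum_u : (\sum_i u i ^ r.+1 <= n ^ r.+1)%N.
  apply: (@leq_trans (\sum_i 'C(#|nbrs E i|, r.+1) * r.+1`!)).
    by apply: leq_sum => i _; rewrite bin_ffact expn_le_ffact.
  rewrite -big_distrl /=; apply: (@leq_trans ('C(n, r.+1) * r.+1`!)).
    by rewrite leq_mul2r sum_bin_nbrs ?orbT.
  by rewrite bin_ffact ffact_le_expn.
have card_E : (#|E| <= \sum_i u i + m * r.+1)%N.
  rewrite card_edges -[m in (m * _)%N]card_ord -sum_nat_const -big_split /=.
  by apply: leq_sum => i _; rewrite addnC -leq_subLR.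
have s_ge0 := ltW s_gt0.
have tangent : m%:R * s ^+ r.+1 + r.+1%:R * s ^+ r * ((\sum_i u i)%:R - m%:R * s)
    <= s ^+ r.+1 * s ^+ r.+1.
  apply: (@le_trans _ _ (\sum_i u i ^ r.+1)%:R); last first.
    rewrite -exprD addnn -mul2n exprM s2 -natrX ler_nat.
    exact: sum_u.
  rewrite !natr_sum; under [X in _ <= X]eq_bigr do rewrite natrX.
  apply: (@le_trans _ _ (\sum_(i < m) (s ^+ r.+1 + r.+1%:R * s ^+ r * ((u i)%:R - s)))).
    rewrite big_split /= -mulr_sumr sumrB !sumr_const !card_ord.
    by rewrite -[s ^+ _ *+ m]mulr_natl -[s *+ m]mulr_natl.
  by apply: ler_sum => i _; apply: tangent_exp.
have : #|E|%:R <= (\sum_i u i)%:R + m%:R * r.+1%:R :> R.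
  by rewrite -natrM -natrD ler_nat.
have sr_gt0 : 0 < s ^+ r by rewrite exprn_gt0.
move: tangent; rewrite exprS; move: (\sum_i u i)%:R => U tangent le_E.
rewrite -(ler_pM2l sr_gt0).
have w_gt0 : 0 < r.+1%:R :> R by rewrite ltr0n.
move: (s ^+ r) (r.+1%:R) (m%:R) (#|E|%:R) sr_gt0 w_gt0 tangent le_E => p w M z.
move=> {E E_free u sum_u card_E s_gt0 s_ge0 s2} p_gt0 w_gt0 tangent le_E.
apply: (@le_trans _ _ (w * p * (U - M * s))); last by lra.
by rewrite mulrA [p * _]mulrC ler_pM2l ?mulr_gt0 //; lra.
Qed.

Lemma exprB1_ge (R : realDomainType) (e : R) (r : nat) : 0 <= e <= 1 ->
  1 - r%:R * e <= (1 - e) ^+ r.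
Proof.
move=> /andP[e_ge0 e_le1]; elim: r => [|r IHr]; first by rewrite mul0r subr0 expr0.
rewrite exprS; have h : (1 - e) * (1 - r%:R * e) <= (1 - e) * (1 - e) ^+ r.
  by apply: ler_wpM2l => //; lra.
apply: le_trans h; rewrite -natr1.
have : 0 <= r%:R * (e * e) by rewrite mulr_ge0 // mulr_ge0.
by move: (r%:R) => q; lra.
Qed.

(** Above, the relative errors are [2 e] from [s ^+ r - m] and [e] from the term [m * r]. Below,
    they are [(r + 1) * e] from the number of polynomials and [e] from [q] against [s]. Both totals
    are at most [(r + 2) * e]. *)
Lemma zarankiewicz_approx (R : realType) (r : nat) (e : R) : (0 < r)%N ->
  0 < e <= 1 / 2 -> exists S : R, forall (m n : nat) (s : R),
  S <= s -> s ^+ 2 = n%:R -> `|m%:R - s ^+ r| <= e * s ^+ r ->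
  `|(zarankiewicz m n 2 r)%:R - s * m%:R| <= (r.+2%:R * e) * (s * m%:R).
Proof.
move=> r_gt0 /andP[e_gt0 e_le].
have [X HX] := prime_power_between e_gt0.
(* The bound [r / e] gives [m * r <= e * s * m]; the bound [X / (1 - e)] gives a prime power [q]
   above [(1 - e) * s] and at most [(1 + e) * (1 - e) * s], hence at most [s]. *)
exists (Num.max (Num.max 1 (r%:R / e)) (X / (1 - e))) => m n s.
rewrite !ge_max -andbA => /and3P[s_ge1 s_ge_r s_geX] s2 m_near.
have s_gt0 : 0 < s by lra.
have sr_gt0 : 0 < s ^+ r by rewrite exprn_gt0.
have {m_near} [m_lb m_ub] : (1 - e) * s ^+ r <= m%:R /\ m%:R <= (1 + e) * s ^+ r.
  by move: m_near; rewrite ler_distl => /andP[h1 h2]; split; lra.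
have mR_ge0 : 0 <= m%:R :> R by [].
have r_ge1 : 1 <= r%:R :> R by rewrite ler1n.
have upper : (zarankiewicz m n 2 r)%:R - s * m%:R <= r.+2%:R * e * (s * m%:R).
  have := zarankiewicz_le m r_gt0 s_gt0 s2; set z := (zarankiewicz m n 2 r)%:R => z_le.
  rewrite ler_pdivrMr // in s_ge_r.
  have sr_le : s ^+ r - m%:R <= 2 * e * m%:R.
    have : e * ((1 - e) * s ^+ r) <= e * m%:R by rewrite ler_pM2l.
    have : e * (1 / 2 * s ^+ r) <= e * ((1 - e) * s ^+ r).
      by rewrite ler_pM2l // ler_pM2r //; lra.
    by lra.
  have h1 : s * (s ^+ r - m%:R) <= s * (2 * e * m%:R) by rewrite ler_pM2l.
  have h2 : z - m%:R * r%:R - m%:R * s <= s * (2 * e * m%:R).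
    have h3 : r%:R * (z - m%:R * r%:R - m%:R * s) <= s * (2 * e * m%:R) by apply: le_trans h1.
    have ge0 : 0 <= s * (2 * e * m%:R) by rewrite mulr_ge0 ?mulr_ge0 // ltW.
    have [neg|pos] := ltP (z - m%:R * r%:R - m%:R * s) 0.
      exact: le_trans (ltW neg) ge0.
    by apply: le_trans h3; rewrite ler_peMl.
  have h4 : m%:R * r%:R <= m%:R * (s * e) by rewrite ler_wpM2l.
  have h5 : 3 * (e * (s * m%:R)) <= r.+2%:R * (e * (s * m%:R)).
    by rewrite ler_wpM2r ?ler_nat ?ltnS // !mulr_ge0 // ltW.
  by rewrite -mulrA; lra.
have lower : s * m%:R - (zarankiewicz m n 2 r)%:R <= r.+2%:R * e * (s * m%:R).
  have sm_ge0 : 0 <= s * m%:R by rewrite mulr_ge0 // ltW.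
  have def_r2 : r.+2%:R = r%:R + 2 :> R by rewrite -addn2 natrD.
  (* For large [e] the bound is trivial; otherwise [1 - (r + 1) * e] is nonnegative and inequalities
     may be multiplied by it. *)
  have [big_e|small_e] := ltP 1 (r.+2%:R * e).
    have z_ge0 : 0 <= (zarankiewicz m n 2 r)%:R :> R by [].
    have : 1 * (s * m%:R) <= r.+2%:R * e * (s * m%:R) by rewrite ler_wpM2r // ltW.
    by lra.
  have e1_gt0 : 0 < 1 - e by lra.
  have x_ge : X <= (1 - e) * s by rewrite mulrC -ler_pdivrMr.
  have [p [k [p_pr k_gt0 /andP[lt_q q_le]]]] := HX _ x_ge.
  have [F _ card_F] := pPrimePowerField p_pr k_gt0.
  rewrite -card_F in lt_q q_le; set q := #|F| in lt_q q_le.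
  have q_le_s : q%:R <= s.
    apply: le_trans q_le _; rewrite mulrA ler_piMl ?(ltW s_gt0) //.
    by have : 0 <= e * e by [rewrite mulr_ge0 // ltW]; lra.
  have qn : (q ^ 2 <= n)%N.
    by rewrite -(ler_nat R) -s2 natrX lerXn2r ?nnegrE // ltW.
  have := @zarankiewicz_ge F m n r r_gt0 qn; rewrite -(ler_nat R) natrM -/q.
  set z := (zarankiewicz m n 2 r)%:R => z_ge; have q_ge0 : 0 <= q%:R :> R by [].
  (* By Bernoulli's inequality [q ^ r] is at least [(1 - r * e) * s ^+ r], and
     [(1 - (r + 1) * e) * (1 + e) <= 1 - r * e]. *)
  have min_ge : (1 - (r%:R + 1) * e) * m%:R <= (minn m (q ^ r))%:R.
    rewrite /minn; case: ltnP => _.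
      by rewrite ler_piMl // lerBlDr lerDl mulr_ge0 ?addr_ge0 // ltW.
    rewrite natrX; have h1 : ((1 - e) * s) ^+ r <= q%:R ^+ r.
      by rewrite lerXn2r ?nnegrE ?(ltW lt_q) // mulr_ge0 // ltW.
    apply: le_trans h1; rewrite exprMn.
    have h2 : (1 - r%:R * e) * s ^+ r <= (1 - e) ^+ r * s ^+ r.
      by rewrite ler_pM2r // exprB1_ge //; apply/andP; split; lra.
    apply: le_trans h2.
    have h3 : (1 - (r%:R + 1) * e) * m%:R <= (1 - (r%:R + 1) * e) * ((1 + e) * s ^+ r).
      by rewrite ler_wpM2l // subr_ge0; rewrite def_r2 in small_e; lra.
    apply: le_trans h3 _; rewrite mulrA ler_pM2r //.
    have : 0 <= (r%:R + 1) * (e * e) by rewrite mulr_ge0 ?addr_ge0 ?mulr_ge0 // ltW.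
    by lra.
  have h1 : (1 - (r%:R + 1) * e) * m%:R * ((1 - e) * s) <= z.
    apply: le_trans z_ge; apply: ler_pM => //; last exact: ltW.
      by rewrite mulr_ge0 // subr_ge0; rewrite def_r2 in small_e; lra.
    by rewrite mulr_ge0 // ltW.
  have h2 : 0 <= (r%:R + 1) * (e * e) * (s * m%:R).
    by rewrite mulr_ge0 // mulr_ge0 ?addr_ge0 ?mulr_ge0 // ltW.
  by rewrite def_r2; lra.
by rewrite ler_distl; apply/andP; split; lra.
Qed.

(** * The asymptotic formula *)

Local Open Scope classical_set_scope.
Local Open Scope ring_scope.

Theorem theorem5 (R : realType) (r : nat) (hr : (3 <= r)%N) (m : nat -> nat)
    (hm : (fun n : nat => (m n)%:R : R)
            ~_\oo (fun n : nat => n%:R `^ (r%:R / 2))) :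
  (fun n : nat => (zarankiewicz (m n) n 2 r)%:R : R)
    ~_\oo (fun n : nat => Num.sqrt n%:R * (m n)%:R).
Proof.
have r_gt0 : (0 < r)%N by apply: leq_trans hr.
move/eqaddoP in hm; apply/eqaddoP => eps eps_gt0.
(* The division by [r + 2] compensates the constant of [zarankiewicz_approx]. *)
pose e := Num.min (1 / 2) (eps / r.+2%:R).
have e_itv : 0 < e <= 1 / 2 by rewrite lt_min ge_min lexx !divr_gt0.
have e_gt0 : 0 < e by case/andP: e_itv.
have e_eps : r.+2%:R * e <= eps by rewrite mulrC -ler_pdivlMr // ge_min lexx orbT.
have [S HS] := zarankiewicz_approx r_gt0 e_itv.
near=> n; rewrite /= !fctE.
have s_pow : n%:R `^ (r%:R / 2) = Num.sqrt n%:R ^+ r :> R.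
  by rewrite mulrC powRrM powR12_sqrt // powR_mulrn // sqrtr_ge0.
apply: (@le_trans _ _ (r.+2%:R * e * (Num.sqrt n%:R * (m n)%:R))).
  apply: HS.
  - near: n; exists (Num.trunc (S ^+ 2)).+1 => // n /= lt_n.
    have [S_le0|S_gt0] := leP S 0; first by apply: le_trans S_le0 (sqrtr_ge0 _).
    rewrite -(ler_sqr (x := S)) ?nnegrE ?sqrtr_ge0 ?(ltW S_gt0) // sqr_sqrtr //.
    by apply/ltW/(lt_le_trans (truncnS_gt _)); rewrite ler_nat.
  - by rewrite sqr_sqrtr.
  - rewrite -s_pow -[X in _ <= e * X]ger0_norm ?powR_ge0 //.
    by near: n; apply: hm.
rewrite [X in _ <= _ * X]ger0_norm ?mulr_ge0 ?sqrtr_ge0 //.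
by rewrite ler_wpM2r // mulr_ge0 // sqrtr_ge0.
Unshelve. all: by end_near.
Qed.
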